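(* Let $\xi$ be a real random variable with mean zero and variance one, let $A,C>0$ be arbitrary constants, let $K$ be a fixed positive integer, and let $r>0$ be a fixed constant. Let $d\in\{1,2,4\}$ and for $1\le i\le n$ let $\mathbf w_i\in\mathbb R^d$ be one of: (d=1) $\mathbf w_i=b_i(x)$ with $x\in I_W$; (d=2) $\mathbf w_i=(b_i(x),c_i(x))$ with $x\in I_W$; (d=4) $\mathbf w_i=(b_i(x),c_i(x),b_i(y),c_i(y))$ with $x,y\in I_W$, $|x-y|\ge N^{\varepsilon_g}$ for a fixed constant $0<\varepsilon_g<1/2$. Let $\phi_i(\eta)=\mathbb E\exp(\mathrm i\,\xi\langle\mathbf w_i,\eta\rangle)$ for $\eta\in\mathbb R^d$. Then, provided $N$ is sufficiently large, for every index set $I\subset\{1,\dots,n\}$ with $|I|\le K$ and every $\eta\in\mathbb R^d$ with $r\le\|\eta\|_2^2\le N^{A}$, \[\Big|\prod_{i\notin I}\phi_i(\eta)\Big|\le N^{-C}.\]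
   Context: Let $0<c_1<c_2$ be constants, $n$ a large integer and $M$ a large parameter (possibly growing with $n$) with $I_W:=[c_1M,c_2M]\subset[0,\sqrt n-M]$; set $N:=M$. For $x>0$ and $1\le i\le n$ let $b_i(x)=\sqrt N\,e^{-x^2/2}\,x^i/\sqrt{i!}$ and $c_i(x)=b_i'(x)=\sqrt N\,e^{-x^2/2}\,\frac{i-x^2}{x}\,\frac{x^i}{\sqrt{i!}}$. These are the step vectors of the random walks $\sum_{i=1}^n\xi_i\mathbf w_i$ associated to Weyl polynomials. *)

(* Defs.v *)
From HB Require Import structures.
From mathcomp Require Import all_boot all_order all_algebra.
From mathcomp Require Import all_classical all_reals all_analysis.
From mathcomp Require Import complex.
Import Order.TTheory GRing.Theory Num.Theory.
Import numFieldNormedType.Exports.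

Set Implicit Arguments.
Unset Strict Implicit.
Unset Printing Implicit Defensive.

Local Open Scope ring_scope.

Section Weyl.
Variable R : realType.

Definition weyl_b (N x : R) (i : nat) : R :=
  Num.sqrt N * expR (- (x ^+ 2) / 2) * x ^+ i / Num.sqrt (i`!)%:R.

(* c_i(x) = b_i'(x) = sqrt N e^{-x^2/2} (i - x^2)/x * x^i / sqrt(i!) *)
Definition weyl_c (N x : R) (i : nat) : R :=
  Num.sqrt N * expR (- (x ^+ 2) / 2) * ((i%:R - x ^+ 2) / x)
    * (x ^+ i / Num.sqrt (i`!)%:R).

Definition w1 (N x : R) (i : nat) : 'rV[R]_1 := \row_(j < 1) weyl_b N x i.
Definition w2 (N x : R) (i : nat) : 'rV[R]_2 :=
  \row_(j < 2) (if val j == 0%N then weyl_b N x i else weyl_c N x i).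
Definition w4 (N x y : R) (i : nat) : 'rV[R]_4 :=
  \row_(j < 4) (match val j with
                | 0%N => weyl_b N x i
                | 1%N => weyl_c N x i
                | 2%N => weyl_b N y i
                | _ => weyl_c N y i end).

Definition dotv d (u v : 'rV[R]_d) : R := \sum_(j < d) u ord0 j * v ord0 j.
Definition sqnorm d (v : 'rV[R]_d) : R := \sum_(j < d) v ord0 j ^+ 2.

Definition charfn dT (T : measurableType dT) (P : probability T R)
    (X : T -> R) (t : R) : complex.complex R :=
  complex.Complex (fine ('E_P[fun w => cos (t * X w)])%E)
                  (fine ('E_P[fun w => sin (t * X w)])%E).

Definition phi dT (T : measurableType dT) (P : probability T R) (X : T -> R)
    d (w : nat -> 'rV[R]_d) (eta : 'rV[R]_d) (i : nat) : complex.complex R :=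
  charfn P X (dotv (w i) eta).

Definition cf_product_bound dT (T : measurableType dT) (P : probability T R)
    (X : T -> R) (A C : R) (K : nat) (r : R) (n : nat) (N : R)
    d (w : nat -> 'rV[R]_d) : Prop :=
  forall (I : seq nat), uniq I -> {subset I <= iota 1 n} -> (size I <= K)%N ->
  forall eta : 'rV[R]_d, r <= sqnorm eta -> sqnorm eta <= powR N A ->
  `| \prod_(1 <= i < n.+1 | i \notin I) phi P X w eta i |
    <= complex.Complex (powR N (- C)) 0.

End Weyl.

(* Main.v *)
(** Only small arguments of the characteristic function matter.  If [xi] has mean zero
    and variance one then [|phi t|^2 <= 1 - t^2 / 8] for small [t], while [|phi| <= 1]
    everywhere.  Hence it suffices to find, for every [eta], at least a constant times
    [sqrt M] indices [i] at which [<w_i, eta>] has size comparable to one fixed small [T].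

    Put [u = (i - x^2) / x], so that [<w_i, eta>] is [b_i(x) (a + b u)] plus the similar
    term for [y], and suppose that [a^2 + b^2 >= r / 2].  On the side of [x^2] where [a]
    and [b u] have the same sign, [|b_i(x) (a + b u)|] is at least [T] for [u] close to 1
    (Stirling), is super-polynomially small for [|u|] of order [M^eps] (Chernoff), and
    changes by a factor [1 + O(M^(eps - 1))] from one index to the next, so it needs many
    steps to leave [[T / 2, 2 T]] once it has crossed [T].  The [y]-term is negligible
    there, because [|x^2 - y^2|] exceeds the width of the windows by the factor [M^eps]. *)

Require Import Defs.
From HB Require Import structures.
From mathcomp Require Import all_boot all_order all_algebra.
From mathcomp Require Import all_classical all_reals all_analysis.
From mathcomp Require Import complex ring lra zify.
From mathcomp Require Import measurable_realfun.
Import Order.TTheory GRing.Theory Num.Theory.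
Import numFieldNormedType.Exports.

Set Implicit Arguments.
Unset Strict Implicit.
Unset Printing Implicit Defensive.
Local Open Scope ring_scope.

(** * Elementary inequalities *)

Section Elementary.
Variable R : realType.
Implicit Types x y t : R.

(** Mean value theorem on [[0, x]]. The Taylor estimates below follow from it by reading off the
    sign of a derivative, each from one of lower order. *)
Lemma is_derive_nondecr_ge0 (f df : R -> R) x :
  (forall t, is_derive t 1 f (df t)) -> f 0 = 0 ->
  (forall t, 0 <= t -> 0 <= df t) -> 0 <= x -> 0 <= f x.
Proof.
move=> fd f0 df0 x0.
have fc : {within `[0, x], continuous f}%classic.
  apply: derivable_within_continuous => t _.
  exact: (@ex_derive _ _ _ _ _ _ _ (fd t)).
have [c /[!in_itv]/= /andP[c0 _] fx] := MVT_segment x0 (fun t _ => fd t) fc.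
by move: fx; rewrite f0 !subr0 => ->; rewrite mulr_ge0 ?df0.
Qed.

Lemma sin_le_id x : 0 <= x -> sin x <= x.
Proof.
move=> x0; rewrite -subr_ge0.
have d t : is_derive t 1 (fun t : R => t - sin t) (1 - cos t).
  by apply: is_derive_eq; rewrite /GRing.scale /=; field.
apply: (is_derive_nondecr_ge0 d _ _ x0).
- by rewrite sin0 subr0.
- by move=> t _; rewrite subr_ge0 cos_le1.
Qed.

Lemma cos_ge_1Bx x : 0 <= x -> 1 - x <= cos x.
Proof.
move=> x0; rewrite -subr_ge0.
have d t : is_derive t 1 (fun t : R => cos t - (1 - t)) (1 - sin t).
  by apply: is_derive_eq; rewrite /GRing.scale /=; field.
apply: (is_derive_nondecr_ge0 d _ _ x0).
- by rewrite cos0 ?subr0 ?expr0n /= ?mul0r ?subr0 ?subrr.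
- by move=> t _; rewrite subr_ge0 sin_le1.
Qed.

Lemma sin_ge_xBsqr x : 0 <= x -> x - x ^+ 2 / 2 <= sin x.
Proof.
move=> x0; rewrite -subr_ge0.
have d t : is_derive t 1 (fun t : R => sin t - (t - t ^+ 2 / 2)) (cos t - (1 - t)).
  by apply: is_derive_eq; rewrite /GRing.scale /=; field.
apply: (is_derive_nondecr_ge0 d _ _ x0).
- by rewrite sin0 ?subr0 ?expr0n /= ?mul0r ?subr0 ?subrr.
- by move=> t /cos_ge_1Bx; rewrite subr_ge0.
Qed.

Lemma cos_ge_1Bsqr x : 1 - x ^+ 2 / 2 <= cos x.
Proof.
wlog x0 : x / 0 <= x.
  move=> h; case: (lerP 0 x) => [/h //|x0]; rewrite -cosN -sqrrN; apply: h.
  by rewrite oppr_ge0 ltW.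
rewrite -subr_ge0.
have d t : is_derive t 1 (fun t : R => cos t - (1 - t ^+ 2 / 2)) (t - sin t).
  by apply: is_derive_eq; rewrite /GRing.scale /=; field.
apply: (is_derive_nondecr_ge0 d _ _ x0).
- by rewrite cos0 ?subr0 ?expr0n /= ?mul0r ?subr0 ?subrr.
- by move=> t /sin_le_id; rewrite subr_ge0.
Qed.

Lemma cos_le_cubic x : cos x <= 1 - x ^+ 2 / 2 * (1 - `|x| / 3).
Proof.
wlog x0 : x / 0 <= x.
  move=> h; case: (lerP 0 x) => [/h //|x0].
  by rewrite -cosN -sqrrN -normrN; apply: h; rewrite oppr_ge0 ltW.
rewrite (ger0_norm x0) -subr_ge0.
have d t : is_derive t 1 (fun t : R => 1 - t ^+ 2 / 2 * (1 - t / 3) - cos t) (sin t - (t - t ^+ 2 / 2)).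
  by apply: is_derive_eq; rewrite /GRing.scale /=; field.
apply: (is_derive_nondecr_ge0 d _ _ x0).
- by rewrite cos0 ?subr0 ?expr0n /= ?mul0r ?subr0 ?subrr.
- by move=> t /sin_ge_xBsqr; rewrite subr_ge0.
Qed.

(** A quadratic error can be integrated when only a second moment is available. *)
Lemma normr_sinB_le x : `|sin x - x| <= x ^+ 2 / 2.
Proof.
wlog x0 : x / 0 <= x.
  move=> h; case: (lerP 0 x) => [/h //|x0].
  rewrite -normrN (_ : - (sin x - x) = sin (- x) - - x); last by rewrite sinN; ring.
  by rewrite -(sqrrN x); apply: h; rewrite oppr_ge0 ltW.
have := sin_le_id x0; have := sin_ge_xBsqr x0.
by rewrite ler_norml => ? ?; apply/andP; split; lra.
Qed.

(** The positive part makes the bound valid for all [x], so that it can be integrated without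
    splitting the sample space. *)
Lemma one_sub_cos_ge x : x ^+ 2 / 2 * Num.max 0 (1 - `|x| / 3) <= 1 - cos x.
Proof.
have := cos_le_cubic x; have := cos_le1 x.
by rewrite /Num.max; case: ifP => _ ? ?; lra.
Qed.

End Elementary.

(** * Characteristic functions near the origin *)

Section CharFn.
Variables (R : realType) (dT : measure_display) (T : measurableType dT).
Variables (P : probability T R).

Lemma integrable_bounded (f : T -> R) (B : R) :
  measurable_fun setT f -> (forall w, `|f w| <= B) ->
  P.-integrable setT (EFin \o f).
Proof.
move=> mf fB; apply: measurable_bounded_integrable => //.
  by rewrite (le_lt_trans (probability_le1 P _)) ?ltry.
by exists B; split; [exact: num_real | move=> x Bx w _; exact: le_trans (fB w) (ltW Bx)].
Qed.

Lemma integrableD_RV (f g : T -> R) :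
  P.-integrable setT (EFin \o f) -> P.-integrable setT (EFin \o g) ->
  P.-integrable setT (EFin \o (fun w => f w + g w)).
Proof. by move=> fi gi; exact: (integrableD measurableT fi gi). Qed.

Lemma integrableB_RV (f g : T -> R) :
  P.-integrable setT (EFin \o f) -> P.-integrable setT (EFin \o g) ->
  P.-integrable setT (EFin \o (fun w => f w - g w)).
Proof. by move=> fi gi; exact: (integrableB measurableT fi gi). Qed.

Lemma integrableZ_RV (c : R) (f : T -> R) :
  P.-integrable setT (EFin \o f) -> P.-integrable setT (EFin \o (fun w => c * f w)).
Proof. by move=> fi; exact: (integrableZl measurableT c fi). Qed.

Lemma measurable_cosM (X : {RV P >-> R}) (t : R) :
  measurable_fun setT (fun w => cos (t * X w)).
Proof.
apply: (measurableT_comp (f := cos)).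
  by apply: continuous_measurable_fun; exact: continuous_cos.
exact: measurable_funM.
Qed.

Lemma measurable_sinM (X : {RV P >-> R}) (t : R) :
  measurable_fun setT (fun w => sin (t * X w)).
Proof.
apply: (measurableT_comp (f := sin)).
  by apply: continuous_measurable_fun; exact: continuous_sin.
exact: measurable_funM.
Qed.

Lemma integrable_cosM (X : {RV P >-> R}) (t : R) :
  P.-integrable setT (EFin \o (fun w => cos (t * X w))).
Proof.
by apply: (@integrable_bounded _ 1 (measurable_cosM X t)) => w; exact: cos_max.
Qed.

Lemma integrable_sinM (X : {RV P >-> R}) (t : R) :
  P.-integrable setT (EFin \o (fun w => sin (t * X w))).
Proof.
by apply: (@integrable_bounded _ 1 (measurable_sinM X t)) => w; exact: sin_max.
Qed.

Lemma Rintegral_probability_cst (r : R) : \int[P]_w r = r.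
Proof. by rewrite Rintegral_cst// [X in fine X](probability_setT P) mulr1. Qed.

Lemma charfnE (X : T -> R) t :
  charfn P X t = complex.Complex (\int[P]_w cos (t * X w)) (\int[P]_w sin (t * X w)).
Proof. by rewrite /charfn !unlock. Qed.

(** Squared modulus of the characteristic function, which keeps the estimates real. *)
Definition charfn_sqr (X : T -> R) t : R :=
  (\int[P]_w cos (t * X w)) ^+ 2 + (\int[P]_w sin (t * X w)) ^+ 2.

Lemma charfn_sqr_ge0 X t : 0 <= charfn_sqr X t.
Proof. by rewrite addr_ge0 ?sqr_ge0. Qed.

(* With [a + i b] the value at [t], [a^2 + b^2] is the mean of
   [a cos (t X) + b sin (t X)], which is at most [sqrt (a^2 + b^2)]. *)
Lemma charfn_sqr_le1 (X : {RV P >-> R}) t : charfn_sqr X t <= 1.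
Proof.
set s := charfn_sqr X t.
set a := \int[P]_w cos (t * X w); set b := \int[P]_w sin (t * X w).
have ic := integrable_cosM X t; have isn := integrable_sinM X t.
have ica : P.-integrable setT (EFin \o (fun w => a * cos (t * X w))) by exact: integrableZ_RV.
have isb : P.-integrable setT (EFin \o (fun w => b * sin (t * X w))) by exact: integrableZ_RV.
have sE : s = \int[P]_w (a * cos (t * X w) + b * sin (t * X w)).
  by rewrite RintegralD ?RintegralZl.
(* Pointwise [2 a cos + 2 b sin <= a^2 + b^2 + 1], so [s <= (s + 1) / 2]. *)
have : s <= \int[P]_w (1 / 2 * (s + 1)).
  rewrite [leLHS]sE; apply: le_Rintegral => //.
  - exact: (integrableD_RV ica isb).
  - by apply: (@integrable_bounded _ `|1 / 2 * (s + 1)|) => [|w]; [exact: measurable_cst|].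
  move=> w _.
  have h := cos2Dsin2 (t * X w).
  have e : s = a ^+ 2 + b ^+ 2 by [].
  have := sqr_ge0 (a - cos (t * X w)); have := sqr_ge0 (b - sin (t * X w)).
  by rewrite e; nra.
by rewrite Rintegral_probability_cst; lra.
Qed.

(** A continuous cutoff of [X^2] whose shape matches the lower bound for [1 - cos]. *)
Definition truncated_sqr (X : T -> R) n w : R :=
  X w ^+ 2 * Num.max 0 (1 - `|X w| / n.+1%:R).

Lemma truncated_sqr_itv X n w : 0 <= truncated_sqr X n w <= X w ^+ 2.
Proof.
have : 0 <= Num.max 0 (1 - `|X w| / n.+1%:R) <= 1.
  by rewrite le_max lexx /= ge_max ler01 /= gerBl divr_ge0.
by case/andP => h0 h1; rewrite mulr_ge0 ?sqr_ge0 //= ler_piMr ?sqr_ge0.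
Qed.

Lemma measurable_truncated_sqr (X : {RV P >-> R}) n :
  measurable_fun setT (truncated_sqr X n).
Proof.
have mX : measurable_fun setT (X : T -> R) by [].
apply: measurable_funM; first exact: measurable_funX.
apply: measurable_maxr => //; apply: measurable_funB => //.
by apply: measurable_funM => //; exact: measurableT_comp.
Qed.

Lemma integrable_truncated_sqr (X : {RV P >-> R}) n :
  P.-integrable setT (EFin \o (fun w => X w ^+ 2)) ->
  P.-integrable setT (EFin \o truncated_sqr X n).
Proof.
apply: le_integrable => //.
  exact/measurable_EFinP/measurable_truncated_sqr.
move=> w _ /=; case/andP: (truncated_sqr_itv X n w) => h0 h1.
by rewrite lee_fin !ger0_norm// sqr_ge0.
Qed.

(** Dominated convergence with dominating function [X^2]: the cutoff factor tends to 1 pointwise, so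
    the truncated means tend to 1. *)
Lemma truncated_second_moment (X : {RV P >-> R}) :
  P.-integrable setT (EFin \o (fun w => X w ^+ 2)) -> \int[P]_w (X w ^+ 2) = 1 ->
  exists n : nat, 1 / 2 <= \int[P]_w truncated_sqr X n w.
Proof.
move=> iX eX.
pose f n w := truncated_sqr X n w.
have mf n : measurable_fun setT (f n) by exact: measurable_truncated_sqr.
have f0 n w : 0 <= f n w by case/andP: (truncated_sqr_itv X n w).
have f1 n w : f n w <= X w ^+ 2 by case/andP: (truncated_sqr_itv X n w).
have cvgf w : (f n w @[n --> \oo] --> X w ^+ 2)%classic.
  apply: (@squeeze_cvgr _ _ _ _ (fun n => X w ^+ 2 - `|X w| ^+ 3 * harmonic n) (fun=> X w ^+ 2)).
  - apply: nearW => n; rewrite f1 andbT -subr_ge0.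
    have -> : f n w - (X w ^+ 2 - `|X w| ^+ 3 * harmonic n) =
      X w ^+ 2 * (Num.max 0 (1 - `|X w| / n.+1%:R) - (1 - `|X w| / n.+1%:R)).
      by rewrite /f /truncated_sqr -(real_normK (num_real (X w))) /harmonic /=; ring.
    by rewrite mulr_ge0 ?sqr_ge0// subr_ge0 le_max lexx orbT.
  - rewrite -[Y in (_ --> Y)%classic]subr0; apply: cvgB; first exact: cvg_cst.
    by rewrite -(mulr0 (`|X w| ^+ 3)); apply: cvgMr; exact: cvg_harmonic.
  - exact: cvg_cst.
have := @dominated_cvg _ _ _ P setT measurableT (fun n => EFin \o f n)
   (EFin \o (fun w => X w ^+ 2)) (EFin \o (fun w => X w ^+ 2)).
move=> /(_ _ _ _ iX) h.
have {}h : ((\int[P]_w (f n w)%:E)%E @[n --> \oo] --> (\int[P]_w (X w ^+ 2)%:E)%E)%classic.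
  apply: h => //.
  - by move=> n; exact/measurable_EFinP.
  - by move=> w _; apply/cvg_EFin; [exact: nearW | exact: cvgf].
  - by move=> n w _; rewrite lee_fin ger0_norm.
have {}h : (\int[P]_w f n w @[n --> \oo] --> (1 : R))%classic.
  by rewrite -eX; apply: fine_cvg; rewrite fineK //; exact: integrable_fin_num.
have /cvgrPdist_le /(_ (1 / 2)) := h.
case; first by lra.
move=> n _ /(_ n (leqnn n)) /=; rewrite ler_norml => /andP[_ hn].
by exists n; rewrite -/(f n); lra.
Qed.

(** With [a + i b] the value at [t], the vanishing mean gives [b = O(t^2)] and the truncated second
    moment gives [a <= 1 - t^2 / 4]; the terms of order [t^4] in [a^2 + b^2] are then absorbed. *)
Lemma charfn_sqr_small (X : {RV P >-> R}) :
  P.-integrable setT (EFin \o X) -> \int[P]_w X w = 0 ->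
  P.-integrable setT (EFin \o (fun w => X w ^+ 2)) -> \int[P]_w (X w ^+ 2) = 1 ->
  exists2 d : R, 0 < d & forall t, `|t| <= d -> charfn_sqr X t <= 1 - t ^+ 2 / 8.
Proof.
move=> iX1 eX1 iX eX.
have [n hn] := truncated_second_moment iX eX.
(* The first bound gives [|t X| / 3 <= |X| / (n + 1)], which compares the two cutoffs; the second
   controls the terms of order [t^4]. *)
pose d : R := Num.min (n.+1%:R^-1) (1 / 2).
have d0 : 0 < d by rewrite lt_min invr_gt0 ltr0Sn /=; lra.
exists d => // t; rewrite le_min => /andP[tn t1].
have ic := integrable_cosM X t; have isn := integrable_sinM X t.
set a := \int[P]_w cos (t * X w).
set b := \int[P]_w sin (t * X w).
have itX : P.-integrable setT (EFin \o (fun w => t * X w)) by exact: integrableZ_RV.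
have iZ (c : R) : P.-integrable setT (EFin \o (fun w => c * X w ^+ 2)) by exact: integrableZ_RV.
have i1 (c : R) : P.-integrable setT (EFin \o (fun _ : T => c)).
  by apply: (@integrable_bounded _ `|c|) => [|w]; [exact: measurable_cst|].
have hq : t ^+ 2 / 2 = \int[P]_w (t ^+ 2 / 2 * X w ^+ 2).
  by rewrite RintegralZl// eX mulr1.
have b_le : `|b| <= t ^+ 2 / 2.
  have -> : b = \int[P]_w (sin (t * X w) - t * X w).
    by rewrite RintegralB// RintegralZl// eX1 mulr0 subr0.
  have isx : P.-integrable setT (EFin \o (fun w => sin (t * X w) - t * X w)).
    exact: (integrableB_RV isn itX).
  apply: le_trans (le_normr_Rintegral _ isx) _ => //.
  rewrite hq; apply: le_Rintegral => //.
    exact: integrable_norm.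
  by move=> w _; rewrite mulrAC -exprMn; exact: normr_sinB_le.
(* This settles the sign of [a] before [a_le] is squared. *)
have a_ge : 1 - t ^+ 2 / 2 <= a.
  rewrite -[X in X - _]Rintegral_probability_cst hq.
  rewrite -RintegralB//; apply: le_Rintegral => //.
    exact: (integrableB_RV (i1 1) (iZ (t ^+ 2 / 2))).
  by move=> w _; rewrite mulrAC -exprMn; exact: cos_ge_1Bsqr.
have a_le : a <= 1 - t ^+ 2 / 4.
  pose g := truncated_sqr X n.
  have ig : P.-integrable setT (EFin \o g) by exact: integrable_truncated_sqr.
  have itg : P.-integrable setT (EFin \o (fun w => t ^+ 2 / 2 * g w)) by exact: integrableZ_RV.
  have : \int[P]_w (t ^+ 2 / 2 * g w) <= \int[P]_w (1 - cos (t * X w)).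
    apply: le_Rintegral => //.
      exact: (integrableB_RV (i1 1) ic).
    move=> w _; apply: le_trans (one_sub_cos_ge _).
    rewrite /g /truncated_sqr exprMn mulrA [t ^+ 2 / 2 * _]mulrAC ler_wpM2l//.
      by rewrite -exprMn divr_ge0 ?sqr_ge0.
    rewrite ge_max le_max lexx /= le_max; apply/orP; right.
    rewrite lerD2l lerN2 normrM ler_pdivrMr// -mulrA mulrC ler_wpM2l//.
    rewrite (le_trans tn)// ler_peMr ?invr_ge0//; lra.
  rewrite RintegralZl// RintegralB// Rintegral_probability_cst -/a => h.
  have := ler_wpM2l (divr_ge0 (sqr_ge0 t) (ler0n R 2)) hn; lra.
have t2 : t ^+ 2 <= 1 / 4.
  rewrite -(real_normK (num_real t)).
  have := normr_ge0 t; nra.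
have b2 : b ^+ 2 <= (t ^+ 2 / 2) ^+ 2.
  rewrite -(real_normK (num_real b)) ler_sqr ?nnegrE ?divr_ge0 ?sqr_ge0//.
have a2 : a ^+ 2 <= (1 - t ^+ 2 / 4) ^+ 2.
  rewrite ler_sqr ?nnegrE//; lra.
rewrite /charfn_sqr -/a -/b.
have := sqr_ge0 t; nra.
Qed.
End CharFn.

(** * Poisson weights *)

Section Poisson.
Variable R : realType.
Implicit Types x y t l : R.

Lemma expR_ge_exprn_fact t n : 0 <= t -> t ^+ n / n`!%:R <= expR t.
Proof.
case: n => [|n] t0.
  by rewrite expr0 fact0 divr1 -expR0 ler_expR.
by rewrite (le_trans _ (expR_ge1Dxn n t0))// lerDr.
Qed.

(** The first diagonal Pade approximant of [expR]; the derivative of the difference is nonnegative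
    because [1 - u <= exp(-u)]. *)
Lemma expR_le_pade t : 0 <= t -> expR t * (1 - t / 2) <= 1 + t / 2.
Proof.
move=> t0; rewrite -subr_ge0.
have d (u : R) : is_derive u 1 (fun u : R => 1 + u / 2 - expR u * (1 - u / 2))
    ((1 - expR u * (1 - u)) / 2).
  by apply: is_derive_eq; rewrite /GRing.scale /=; field.
apply: (is_derive_nondecr_ge0 d _ _ t0).
- by rewrite expR0; ring.
- move=> u _; rewrite divr_ge0// subr_ge0 -[leRHS](expRxMexpNx_1 u) ler_wpM2l ?expR_ge0//.
  exact: expR_ge1Dx.
Qed.

(** This is [(1 + 1/k)^(2k+1) >= e^2], the inductive step of Stirling's bound. *)
Lemma expR2_le_exprn k : (0 < k)%N -> expR 2 * k%:R ^+ (2 * k + 1) <= k.+1%:R ^+ (2 * k + 1) :> R.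
Proof.
move=> k0; have kR : (0 : R) < k%:R by rewrite ltr0n.
(* For this [y] the Pade quotient is exactly [(k + 1) / k], while [y (2k + 1) = 2]. *)
pose y : R := 2 / (2 * k + 1)%:R.
have y0 : 0 <= y by rewrite divr_ge0.
have yE : y * (2 * k%:R + 1) = 2 by rewrite /y natrD natrM; field; lra.
have h : expR y * k%:R <= k.+1%:R.
  have := expR_le_pade y0; rewrite -natr1.
  have -> : 1 - y / 2 = 2 * k%:R / (2 * k%:R + 1) by rewrite /y natrD natrM; field; lra.
  have -> : 1 + y / 2 = (2 * k%:R + 2) / (2 * k%:R + 1) by rewrite /y natrD natrM; field; lra.
  rewrite mulrA ler_pM2r ?invr_gt0; lra.
have -> : expR (2 : R) = expR y ^+ (2 * k + 1).
  by rewrite -expRM_natr natrD natrM yE.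
rewrite -exprMn; apply: lerXn2r => //; rewrite nnegrE// mulr_ge0 ?expR_ge0//.
Qed.

(* Stirling's upper bound, squared to avoid the factor [sqrt k]. *)
Lemma fact_sqr_le k : (0 < k)%N ->
  (k`!%:R) ^+ 2 <= expR (2 - 2 * k%:R) * k%:R ^+ (2 * k + 1) :> R.
Proof.
elim: k => [//|[_ _|k ih _]].
  by rewrite mulr1 subrr expR0 mul1r expr1n expr1n.
have := ih isT; set m := k.+1 => {}ih.
rewrite factS natrM exprMn (_ : (2 * m.+1 + 1 = (2 * m + 1) + 2)%N); last by lia.
rewrite exprD mulrA [leLHS]mulrC ler_wpM2r ?sqr_ge0//.
apply: le_trans ih _.
have -> : 2 - 2 * m%:R = (2 - 2 * m.+1%:R) + 2 :> R by rewrite -[m.+1%:R]natr1; ring.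
by rewrite expRD -mulrA ler_wpM2l ?expR_ge0// expR2_le_exprn.
Qed.

Definition poisson_weight l (i : nat) : R := l ^+ i * expR (- l) / i`!%:R.

Lemma poisson_weight_gt0 l i : 0 < l -> 0 < poisson_weight l i.
Proof. by move=> l0; rewrite !mulr_gt0 ?exprn_gt0 ?expR_gt0 ?invr_gt0 ?ltr0n ?fact_gt0. Qed.

Lemma poisson_weightS l i : poisson_weight l i.+1 * i.+1%:R = poisson_weight l i * l.
Proof.
have fi : i`!%:R != 0 :> R by rewrite pnatr_eq0 -lt0n fact_gt0.
by rewrite /poisson_weight exprS factS natrM -[i.+1%:R]natr1; field; rewrite fi natr1 pnatr_eq0.
Qed.

(* Chernoff bound: compare with the Poisson weight of mean [s = (l + i) / 2]. *)
Lemma poisson_weight_le l i : 0 < l ->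
  poisson_weight l i <= expR (- ((i%:R - l) ^+ 2 / (2 * (l + i%:R)))).
Proof.
move=> l0; have i0 : (0 : R) <= i%:R by [].
pose s := (l + i%:R) / 2; have s0 : 0 < s by rewrite divr_gt0//; lra.
have fi : i`!%:R != 0 :> R by rewrite pnatr_eq0 -lt0n fact_gt0.
have -> : poisson_weight l i = (l / s) ^+ i * (s ^+ i / i`!%:R) * expR (- l).
  rewrite /poisson_weight exprMn exprVn; field.
  by rewrite fi expf_neq0// gt_eqF.
have h1 : (l / s) ^+ i <= expR ((l / s - 1) * i%:R).
  rewrite expRM_natr; apply: lerXn2r; rewrite ?nnegrE ?expR_ge0//.
    exact/ltW/divr_gt0.
  by have := expR_ge1Dx (l / s - 1); rewrite addrC subrK.
have h2 := expR_ge_exprn_fact i (ltW s0).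
have -> : - ((i%:R - l) ^+ 2 / (2 * (l + i%:R))) = (l / s - 1) * i%:R + s - l.
  by rewrite /s; field; lra.
rewrite !expRD; apply: ler_wpM2r; first exact: expR_ge0.
apply: ler_pM => //; first exact/exprn_ge0/ltW/divr_gt0.
by apply: divr_ge0 => //; exact/exprn_ge0/ltW.
Qed.

(** Combines Stirling's bound for [i!] with [l / i >= exp(1 - i/l)]: the exponents add up to
    [2i (1 - i/l) + (2i - 2) - 2l], which equals [-2 (i - l)^2 / l - 2]. *)
Lemma poisson_weight_sqr_ge l i : 0 < l -> (0 < i)%N ->
  expR (- (2 * (i%:R - l) ^+ 2 / l) - 2) / i%:R <= poisson_weight l i ^+ 2.
Proof.
move=> l0 i0; have iR : (0 : R) < i%:R by rewrite ltr0n.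
have fi : (0 : R) < i`!%:R by rewrite ltr0n fact_gt0.
have h : expR (1 - i%:R / l) <= l / i%:R.
  rewrite -[leRHS]invf_div -[1 - _]opprB expRN lef_pV2 ?posrE ?expR_gt0 ?divr_gt0//.
  by have := expR_ge1Dx (i%:R / l - 1); rewrite addrC subrK.
have {}h : expR (1 - i%:R / l) ^+ (2 * i) <= (l / i%:R) ^+ (2 * i).
  by apply: lerXn2r => //; rewrite nnegrE ?expR_ge0 ?divr_ge0 ?(ltW l0).
rewrite /poisson_weight expr_div_n ler_pdivlMr ?exprn_gt0//.
apply: le_trans (ler_wpM2l _ (fact_sqr_le i0)) _; first by rewrite divr_ge0 ?expR_ge0 ?ltW.
rewrite -expRM_natr in h.
have e : expR (- (2 * (i%:R - l) ^+ 2 / l) - 2) =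
   expR ((1 - i%:R / l) * (2 * i)%:R) * expR (- (2 - 2 * i%:R)) * expR (- l) ^+ 2.
  rewrite -expRM_natr -!expRD; congr expR; rewrite natrM; field; lra.
rewrite e [expR (- (2 - _))]expRN exprD expr1.
have e2 : expR (2 - 2 * i%:R) != 0 :> R by rewrite gt_eqF ?expR_gt0.
have -> : expR ((1 - i%:R / l) * (2 * i)%:R) * (expR (2 - 2 * i%:R))^-1 * expR (- l) ^+ 2 / i%:R
   * (expR (2 - 2 * i%:R) * (i%:R ^+ (2 * i) * i%:R)) =
  expR ((1 - i%:R / l) * (2 * i)%:R) * i%:R ^+ (2 * i) * expR (- l) ^+ 2.
  by field; rewrite e2 gt_eqF.
rewrite exprMn -exprM [(i * 2)%N]mulnC ler_wpM2r ?sqr_ge0//.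
by rewrite -ler_pdivlMr ?exprn_gt0// -expr_div_n.
Qed.

End Poisson.

(** * Weyl step vectors *)

Section WeylSteps.
Variable R : realType.
Implicit Types N x y a b t : R.

Lemma weyl_cE N x i : weyl_c N x i = weyl_b N x i * ((i%:R - x ^+ 2) / x).
Proof. by rewrite /weyl_c /weyl_b; ring. Qed.

(** Makes the Poisson tail and mass bounds available: the steps are concentrated at distance of
    order [x] from [x^2]. *)
Lemma weyl_b_sqr N x i : 0 <= N -> weyl_b N x i ^+ 2 = N * poisson_weight (x ^+ 2) i.
Proof.
move=> N0.
have e : expR (- (x ^+ 2) / 2) ^+ 2 = expR (- x ^+ 2).
  by rewrite -expRM_natr divfK// pnatr_eq0.
rewrite /weyl_b /poisson_weight !exprMn exprVn e !sqr_sqrtr// -!exprM.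
by rewrite muln2 -addnn exprD; ring.
Qed.

Lemma weyl_b_ge0 N x i : 0 <= x -> 0 <= weyl_b N x i.
Proof.
by move=> x0; rewrite /weyl_b !mulr_ge0 ?sqrtr_ge0 ?expR_ge0 ?exprn_ge0 ?invr_ge0 ?sqrtr_ge0.
Qed.

Lemma weyl_bS_sqr N x i : 0 <= N ->
  weyl_b N x i.+1 ^+ 2 * i.+1%:R = weyl_b N x i ^+ 2 * x ^+ 2.
Proof. by move=> N0; rewrite !weyl_b_sqr// -mulrA poisson_weightS mulrA. Qed.

(** The share of one point [x] in [<w_i, eta>], factored by [c_i = b_i (i - x^2) / x] into a weight
    and an affine function of [u = (i - x^2) / x]. *)
Definition weyl_lin N x a b (i : nat) : R :=
  weyl_b N x i * (a + b * ((i%:R - x ^+ 2) / x)).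

Lemma weyl_linE N x a b i :
  weyl_lin N x a b i = weyl_b N x i * a + weyl_c N x i * b.
Proof. by rewrite weyl_cE /weyl_lin; ring. Qed.

Lemma normrD_same_sign a t : 0 <= a * t -> `|a + t| = `|a| + `|t|.
Proof.
move=> h; have [a0|a0] := leP 0 a.
  have [t0|t0] := leP 0 t; first by rewrite !ger0_norm ?addr_ge0.
  have -> : a = 0 by apply/eqP; rewrite eq_le a0 andbT leNgt; apply/negP => a1; nra.
  by rewrite normr0 !add0r.
have t0 : t <= 0 by nra.
by rewrite !ler0_norm ?opprD; lra.
Qed.

(** Equal signs give [|a + b u| = |a| + |b| |u| >= |b|], and a move of [u] by [1/x] changes the
    affine factor by [|b| / x]. *)
Lemma linear_ratio a b x u v : 1 <= x -> `|u - v| = x^-1 ->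
  0 <= a * (b * u) -> 1 <= `|u| ->
  `|a + b * v| <= (1 + x^-1) * `|a + b * u|.
Proof.
move=> x1 uv abu u1.
have -> : a + b * v = (a + b * u) - b * (u - v) by ring.
apply: le_trans (ler_normB _ _) _.
rewrite mulrDl mul1r lerD2l normrM uv [leRHS]mulrC ler_wpM2r ?invr_ge0 ?(le_trans ler01)//.
by rewrite normrD_same_sign// normrM; have := normr_ge0 a; have := normr_ge0 b; nra.
Qed.

Lemma le_of_sqr a b : 0 <= a -> 0 <= b -> a ^+ 2 <= b ^+ 2 -> a <= b.
Proof. by move=> a0 b0; rewrite ler_sqr. Qed.

(** The ratio of consecutive squares is [x^2 / (i + 1)], which is within a factor [1 + 2 L / x] of 1
    since [2 L <= x]; its root is closer still. *)
Lemma weyl_b_ratio N x L i : 0 <= N -> 0 < x -> 0 <= L -> 2 * L <= x ->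
  `|i.+1%:R - x ^+ 2| <= x * L ->
  (weyl_b N x i.+1 <= (1 + 2 * L / x) * weyl_b N x i) /\
  (weyl_b N x i <= (1 + 2 * L / x) * weyl_b N x i.+1).
Proof.
move=> N0 x0 L0 Lx; rewrite ler_norml => /andP[h1 h2].
have b0 j : 0 <= weyl_b N x j.
  exact/weyl_b_ge0/ltW.
have E := weyl_bS_sqr x i N0.
pose d := 2 * L / x; rewrite -/d.
have d0 : 0 <= d by rewrite /d !mulr_ge0 ?invr_ge0 ?(ltW x0).
have d10 : 0 <= 1 + d by lra.
have dE : d * x = 2 * L by rewrite /d mulfVK ?gt_eqF.
have k0 : (0 : R) < i.+1%:R by rewrite ltr0n.
set k := i.+1%:R in h1 h2 E k0 *.
have k1 : k <= (1 + d) * x ^+ 2 by nra.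
have k2 : x ^+ 2 <= (1 + d) * k.
  have : x * L <= d * k; last lra.
  have : d * (x * (x - L)) <= d * k by apply: ler_wpM2l => //; nra.
  by apply: le_trans; rewrite mulrA dE; nra.
have d1 : 1 + d <= (1 + d) ^+ 2 by nra.
have b1 := b0 i; have b2 := b0 i.+1.
split.
- apply: le_of_sqr => //; first exact: mulr_ge0.
  rewrite -(ler_pM2r k0) E.
  rewrite [leRHS](_ : _ = weyl_b N x i ^+ 2 * ((1 + d) ^+ 2 * k)); last by ring.
  by apply: ler_wpM2l; rewrite ?sqr_ge0//; nra.
- apply: le_of_sqr => //; first exact: mulr_ge0.
  have x2 : 0 < x ^+ 2 by rewrite exprn_gt0.
  rewrite -(ler_pM2r x2) -E.
  rewrite [leRHS](_ : _ = weyl_b N x i.+1 ^+ 2 * ((1 + d) ^+ 2 * x ^+ 2)); last by ring.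
  by apply: ler_wpM2l; rewrite ?sqr_ge0//; nra.
Qed.

Lemma weyl_lin_ratio N x a b L i :
  let u := (i%:R - x ^+ 2) / x in let v := (i.+1%:R - x ^+ 2) / x in
  0 <= N -> 1 <= x -> 1 <= L -> 2 * L <= x ->
  0 <= a * (b * u) -> 0 <= a * (b * v) -> 1 <= `|u| -> 1 <= `|v| -> `|v| <= L ->
  `|weyl_lin N x a b i.+1| <= (1 + 5 * L / x) * `|weyl_lin N x a b i| /\
  `|weyl_lin N x a b i| <= (1 + 5 * L / x) * `|weyl_lin N x a b i.+1|.
Proof.
move=> u v N0 x1 L1 Lx su sv u1 v1 vL.
have x0 : 0 < x by lra.
have uv : v - u = x^-1 by rewrite /u /v -natr1; field; lra.
have uv1 : `|v - u| = x^-1 by rewrite uv ger0_norm// invr_ge0 ltW.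
have uv2 : `|u - v| = x^-1 by rewrite distrC.
have h : `|i.+1%:R - x ^+ 2| <= x * L.
  by move: vL; rewrite /v normrM normfV (gtr0_norm x0) ler_pdivrMr// mulrC.
have L0 : 0 <= L by lra.
have [b1 b2] := weyl_b_ratio N0 x0 L0 Lx h.
(* The product is [1 + (2 L + 1 + 2 L / x) / x], and [1 <= L], [1 <= x] bound the numerator by
   [5 L]. *)
have c : (1 + 2 * L / x) * (1 + x^-1) <= 1 + 5 * L / x.
  have i0 : 0 < x^-1 by rewrite invr_gt0.
  have i1 : x^-1 <= 1 by rewrite invf_le1.
  set j := x^-1 in i0 i1 *.
  have : 0 <= (L - 1) * j by apply: mulr_ge0; lra.
  have : 0 <= L * (j * (1 - j)) by rewrite mulr_ge0 ?(mulr_ge0 (ltW i0))//; lra.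
  lra.
have b0 j : 0 <= weyl_b N x j.
  exact/weyl_b_ge0/ltW.
have c0 : 0 <= 1 + 2 * L / x by rewrite addr_ge0// !mulr_ge0// invr_ge0 ltW.
have nl j : `|weyl_lin N x a b j| = weyl_b N x j * `|a + b * ((j%:R - x ^+ 2) / x)|.
  by rewrite /weyl_lin normrM (ger0_norm (b0 j)).
rewrite !nl -/u -/v.
split.
- apply: le_trans (ler_pM (b0 _) (normr_ge0 _) b1 (linear_ratio x1 uv2 su u1)) _.
  by rewrite mulrACA; apply: ler_wpM2r => //; rewrite mulr_ge0.
- apply: le_trans (ler_pM (b0 _) (normr_ge0 _) b2 (linear_ratio x1 uv1 sv v1)) _.
  by rewrite mulrACA; apply: ler_wpM2r => //; rewrite mulr_ge0.
Qed.

Lemma sqr_lin_le a b t : (a + b * t) ^+ 2 <= (a ^+ 2 + b ^+ 2) * (1 + t ^+ 2).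
Proof. by have := sqr_ge0 (a * t - b); nra. Qed.

(** Chernoff bound for the Poisson weight, Cauchy-Schwarz for the affine factor. *)
Lemma weyl_lin_sqr_le N x a b i : 0 <= N -> 0 < x ->
  weyl_lin N x a b i ^+ 2 <=
  N * expR (- ((i%:R - x ^+ 2) ^+ 2 / (2 * (x ^+ 2 + i%:R))))
    * ((a ^+ 2 + b ^+ 2) * (1 + ((i%:R - x ^+ 2) / x) ^+ 2)).
Proof.
move=> N0 x0; have x2 : 0 < x ^+ 2 by rewrite exprn_gt0.
rewrite /weyl_lin exprMn weyl_b_sqr//; apply: ler_pM.
- by rewrite mulr_ge0// ltW// poisson_weight_gt0.
- exact: sqr_ge0.
- by rewrite ler_wpM2l// poisson_weight_le.
- exact: sqr_lin_le.
Qed.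

Lemma weyl_lin_sqr_ge N x a b i : 0 <= N -> 1 <= x ->
  let u := (i%:R - x ^+ 2) / x in
  0 <= a * (b * u) -> 1 <= `|u| <= 2 -> (0 < i)%N ->
  N * expR (- 5) * (a ^+ 2 + b ^+ 2) / (2 * x) <= weyl_lin N x a b i ^+ 2.
Proof.
move=> N0 x1 u su /andP[u1 u2] i0.
have x0 : 0 < x by lra.
have x2 : 0 < x ^+ 2 by rewrite exprn_gt0.
have iR : (0 : R) < i%:R by rewrite ltr0n.
have iE : i%:R - x ^+ 2 = u * x by rewrite /u mulfVK ?gt_eqF.
have uu : u ^+ 2 <= 4 by rewrite -(real_normK (num_real u)); have := normr_ge0 u; nra.
have i4 : i%:R <= 4 * x ^+ 2.
  have : u * x <= 2 * x by rewrite ler_wpM2r ?(ltW x0)// (le_trans (ler_norm u)).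
  nra.
(* In the square the exponent is [-2 u^2 - 2 >= -10], and [i <= 4 x^2]. *)
have p : expR (- 5) / (2 * x) <= poisson_weight (x ^+ 2) i.
  apply: le_of_sqr; [by rewrite divr_ge0 ?expR_ge0//; lra | exact/ltW/poisson_weight_gt0 |].
  apply: le_trans (poisson_weight_sqr_ge x2 i0).
  rewrite expr_div_n iE -expRM_natr.
  apply: ler_pM; rewrite ?expR_ge0 ?invr_ge0 ?sqr_ge0//.
    rewrite ler_expR exprMn (_ : 2 * (u ^+ 2 * x ^+ 2) / x ^+ 2 = 2 * u ^+ 2); first lra.
    by field; rewrite gt_eqF.
  by rewrite lef_pV2 ?posrE ?exprn_gt0//; nra.
have q : a ^+ 2 + b ^+ 2 <= (a + b * u) ^+ 2.
  rewrite -[leRHS]real_normK ?num_real// normrD_same_sign// normrM.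
  rewrite -[a ^+ 2]real_normK ?num_real// -[b ^+ 2]real_normK ?num_real//.
  have := normr_ge0 a; have := normr_ge0 b; set b' := `|b|; set a' := `|a| => b0 a0.
  have : b' ^+ 2 <= (b' * `|u|) ^+ 2.
    by rewrite ler_sqr ?nnegrE ?mulr_ge0// ler_peMr.
  have : 0 <= a' * (b' * `|u|) by rewrite !mulr_ge0.
  nra.
rewrite /weyl_lin exprMn weyl_b_sqr// -/u.
rewrite [leLHS](_ : _ = N * (expR (- 5) / (2 * x)) * (a ^+ 2 + b ^+ 2)); last by field; lra.
apply: ler_pM => //; last by rewrite ler_wpM2l.
  by rewrite !mulr_ge0 ?invr_ge0 ?mulr_ge0 ?expR_ge0 ?(ltW x0).
by rewrite addr_ge0 ?sqr_ge0.
Qed.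

End WeylSteps.

(** * Slowly varying sequences and growth *)

Section Growth.
Variable R : realType.

Lemma exprn_1D_le2 (d : R) k : 0 <= d -> d * k%:R <= 1 / 2 -> (1 + d) ^+ k <= 2.
Proof.
move=> d0 dk.
have h : (1 + d) ^+ k <= expR (d * k%:R).
  rewrite expRM_natr; apply: lerXn2r; rewrite ?nnegrE ?expR_ge0 ?addr_ge0//.
  exact: expR_ge1Dx.
apply: le_trans h _.
have : expR (d * k%:R) <= expR (1 / 2) by rewrite ler_expR.
have := expR_ge1Dx (- (1 / 2) : R); have := expRxMexpNx_1 (1 / 2 : R).
have := expR_gt0 (1 / 2 : R); nra.
Qed.

(** A discrete intermediate value argument: at the first index [j0] below [T] the predecessor is
    still at least [T], and [m] further steps keep the value within a factor 2. *)
Lemma slow_crossing (h : nat -> R) (T d : R) (J m : nat) :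
  0 < T -> 0 <= d -> d * m.+1%:R <= 1 / 2 ->
  (forall j, (j < J + m)%N -> h j.+1 <= (1 + d) * h j /\ h j <= (1 + d) * h j.+1) ->
  T <= h 0%N -> h J < T ->
  exists2 j0, (j0 <= J)%N & forall j, (j <= m)%N -> T / 2 <= h (j0 + j)%N <= 2 * T.
Proof.
move=> T0 d0 dm hr h0 hJ.
have ex : exists j, h j < T by exists J.
case: (ex_minnP ex) => j0 hj0 minj0.
have j0J : (j0 <= J)%N by exact: minj0.
exists j0 => // j jm.
have d1 : 1 <= 1 + d by lra.
(* The step into [j0] costs one more factor [1 + d], hence [m.+1] in the hypothesis on [d]. *)
have hj0T : T <= (1 + d) * h j0.
  case: j0 hj0 minj0 j0J => [|k] hk mk kJ; first lra.
  have hT : T <= h k by rewrite leNgt; apply/negP => /mk; rewrite ltnn.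
  have [|_ ?] := hr k; first by rewrite (leq_trans kJ)// leq_addr.
  exact: le_trans hT _.
have both : h (j0 + j)%N <= (1 + d) ^+ j * T /\ T <= (1 + d) ^+ j.+1 * h (j0 + j)%N.
  elim: j jm => [|j ih] jm; first by rewrite addn0 expr0 expr1 mul1r ltW.
  have [i1 i2] := ih (ltnW jm).
  have [|r1 r2] := hr (j0 + j)%N.
    by rewrite -addnS; apply: leq_add.
  rewrite addnS; split.
  - by apply: le_trans r1 _; rewrite exprS -mulrA ler_wpM2l//; lra.
  - apply: le_trans i2 _; rewrite [in leRHS]exprSr -[leRHS]mulrA ler_wpM2l// exprn_ge0//; lra.
have [b1 b2] := both.
have p k : (k <= m.+1)%N -> (1 + d) ^+ k <= 2.
  move=> km; apply: exprn_1D_le2 => //; apply: le_trans dm.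
  by rewrite ler_wpM2l// ler_nat.
have p1 := p j (leqW jm); have p2 := p j.+1 jm.
have q : 1 <= (1 + d) ^+ j.+1 by rewrite exprn_ege1.
apply/andP; split.
  have : 0 < h (j0 + j)%N by nra.
  nra.
by apply: le_trans b1 _; rewrite ler_wpM2r// ltW.
Qed.

Lemma near_powR_ge (e K : R) : 0 < e -> \forall M \near +oo, K <= powR M e.
Proof.
move=> e0; near=> M.
have K0 : 0 <= Num.max K 0 by rewrite le_max lexx orbT.
apply: (@le_trans _ _ (powR (powR (Num.max K 0) e^-1) e)).
  by rewrite -powRrM mulVf ?gt_eqF// powRr1// le_max lexx.
apply: ge0_ler_powR; rewrite ?nnegrE ?powR_ge0 ?(ltW e0)//.
all: near: M; exact: nbhs_pinfty_ge.
Unshelve. all: by end_near.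
Qed.

(** One Taylor term of degree [k + 1] with [q (k + 1) >= p + 1] suffices; the spare factor [M]
    absorbs the constants. *)
Lemma near_powR_le_expR (B p c q : R) : 0 < c -> 0 < q ->
  \forall M \near +oo, B * powR M p <= expR (c * powR M q).
Proof.
move=> c0 q0.
have [k hk] : exists k : nat, p + 1 <= q * k.+1%:R.
  exists (Num.truncn ((Num.max 0 (p + 1)) / q)).
  have h : 0 <= Num.max 0 (p + 1) / q by rewrite divr_ge0 ?(ltW q0)// le_max lexx.
  have /andP[_ /ltW] := truncn_itv h.
  rewrite ler_pdivrMr// mulrC => ?; apply: le_trans _ _; last by eassumption.
  by rewrite le_max lexx orbT.
near=> M.
have M1 : 1 <= M by near: M; exact: nbhs_pinfty_ge.
have M0 : 0 < M by lra.
have h := @expR_ge_exprn_fact R (c * powR M q) k.+1.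
apply: le_trans (h _); last by rewrite mulr_ge0 ?powR_ge0 ?ltW.
rewrite exprMn -[powR M q ^+ _]powR_mulrn ?powR_ge0// -powRrM.
have h2 : powR M (p + 1) <= powR M (q * k.+1%:R) by apply: ler_powR.
rewrite powRD in h2; last by rewrite (gt_eqF M0) implybT.
rewrite powRr1 in h2; last exact: ltW.
have f0 : (0 : R) < k.+1`!%:R by rewrite ltr0n fact_gt0.
have ck : 0 < c ^+ k.+1 / k.+1`!%:R by rewrite divr_gt0 ?exprn_gt0.
rewrite mulrAC; apply: le_trans (ler_wpM2l (ltW ck) h2).
rewrite mulrC [leRHS]mulrCA ler_wpM2l ?powR_ge0//.
rewrite -ler_pdivrMl//; near: M; exact: nbhs_pinfty_ge.
Unshelve. all: by end_near.
Qed.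

End Growth.

(** * Windows of moderate steps *)

Section Window.
Variable R : realType.
Implicit Types N M x y a b c d T L : R.

(** [idx] walks away from [x^2] on the side [s]; [th] absorbs the rounding of the starting index, so
    that the distance [x th + j] is exact. *)
Lemma side_index x s : 1 <= x -> s = 1 \/ s = -1 ->
  exists (idx : nat -> nat) (th : R), 1 <= th <= 2 /\
    forall j, j%:R <= x ^+ 2 - 2 * x -> (idx j)%:R = x ^+ 2 + s * (x * th + j%:R).
Proof.
move=> x1 [->|->]; have x0 : 0 < x by lra.
- have h : 0 <= x ^+ 2 + x by nra.
  have /andP[h1 h2] := truncn_itv h.
  exists (fun j => (Num.truncn (x ^+ 2 + x)).+1 + j)%N.
  exists (((Num.truncn (x ^+ 2 + x)).+1%:R - x ^+ 2) / x); split.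
    by rewrite ler_pdivlMr// ler_pdivrMr//; move: h1 h2; rewrite -!natr1 => ? ?; apply/andP; split; lra.
  by move=> j _; rewrite natrD [x * _]mulrC divfK ?gt_eqF//; lra.
- have h : 0 <= x ^+ 2 - x by nra.
  have /andP[h1 h2] := truncn_itv h.
  (* The subtraction is in [nat]; [j <= x^2 - 2 x] keeps it from being cut off at 0. *)
  exists (fun j => Num.truncn (x ^+ 2 - x)%R - j)%N.
  exists ((x ^+ 2 - (Num.truncn (x ^+ 2 - x))%:R) / x); split.
    by rewrite ler_pdivlMr// ler_pdivrMr//; move: h1 h2; rewrite -!natr1 => ? ?; apply/andP; split; lra.
  move=> j hj; rewrite natrB; last first.
    by rewrite -ltnS -(ltr_nat R); lra.
  by rewrite [x * _]mulrC divfK ?gt_eqF//; lra.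
Qed.

(** Walking outward from [|u|] in [[1, 2]], the main term starts at [T] or above and is below [T]
    once [|u|] reaches [L / 2]. [slow_crossing] yields consecutive indices with values in
    [[T / 2, 2 T]], and a perturbation of at most [T / 4] keeps the sum in [[T / 4, 3 T]]. *)
Lemma crossing_window N x y a b c d T L (n : nat) :
  0 <= N -> 0 < T -> 8 <= L -> 10 * L <= x -> x ^+ 2 + x * L <= n%:R ->
  T ^+ 2 <= N * expR (- 5) * (a ^+ 2 + b ^+ 2) / (2 * x) ->
  (forall i, L / 2 <= `|(i%:R - x ^+ 2) / x| <= L -> weyl_lin N x a b i ^+ 2 < T ^+ 2) ->
  (forall i, `|i%:R - x ^+ 2| <= x * L -> `|weyl_lin N y c d i| <= T / 4) ->
  exists S : seq nat, [/\ uniq S, {subset S <= iota 1 n},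
    size S = Num.truncn (x / (10 * L)) &
    forall i, i \in S -> T / 4 <= `|weyl_lin N x a b i + weyl_lin N y c d i| <= 3 * T].
Proof.
move=> N0 T0 L8 Lx xn Tab hend herr.
have x0 : 0 < x by lra.
have x1 : 1 <= x by lra.
(* The side of [x^2] on which [a] and [b u] do not have opposite signs. *)
pose s : R := if 0 <= a * b then 1 else -1.
have s1 : s = 1 \/ s = -1 by rewrite /s; case: ifP => _; [left|right].
have sab : 0 <= s * (a * b).
  rewrite /s; case: ifP => [|/negbT]; first by rewrite mul1r.
  by rewrite -ltNge => ?; lra.
have ns : `|s| = 1 by case: s1 => ->; rewrite ?normrN normr1.
have [idx [th [/andP[th1 th2] hidx]]] := side_index x1 s1.
(* After [J] steps [|u| >= L / 2], where [hend] applies. *)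
pose J := (Num.truncn (x * L / 2)).+1.
have /andP[J1 J2] : x * L / 2 <= J%:R <= x * L / 2 + 1.
  have h : 0 <= x * L / 2 by rewrite !mulr_ge0//; lra.
  have /andP[h1 h2] := truncn_itv h.
  by rewrite (ltW h2) /J -natr1 lerD2r.
(* Chosen with [(5 L / x) (m + 1) <= 1 / 2]; the window consists of the [m + 1] positions from [j0]
   to [j0 + m]. *)
pose m := (Num.truncn (x / (10 * L))).-1.
have q1 : 1 <= x / (10 * L) by rewrite ler_pdivlMr ?mul1r//; lra.
have mE : m.+1 = Num.truncn (x / (10 * L)) by rewrite /m prednK// truncn_gt0.
have m1 : m.+1%:R <= x / (10 * L) by rewrite mE truncn_le; lra.
have q2 : x / (10 * L) <= x by rewrite ler_pdivrMr; [nra|lra].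
have jb j : (j <= J + m)%N -> j%:R <= x * L / 2 + 1 + x.
  rewrite -(ler_nat R) natrD => h; apply: le_trans h _.
  by move: m1; rewrite -natr1 => ?; lra.
have jx j : (j <= J + m)%N -> x * th + j%:R <= x * L.
  by move=> /jb h; nra.
have idxE j : (j <= J + m)%N -> (idx j)%:R = x ^+ 2 + s * (x * th + j%:R).
  by move=> /jb h; apply: hidx; nra.
have uE j : (j <= J + m)%N -> ((idx j)%:R - x ^+ 2) / x = s * (th + j%:R / x).
  by move=> /idxE ->; field; rewrite gt_eqF.
have jx0 (j : nat) : 0 <= j%:R / x by rewrite divr_ge0// ltW.
have nuE j : (j <= J + m)%N -> `|((idx j)%:R - x ^+ 2) / x| = th + j%:R / x.
  by move=> /uE ->; rewrite normrM ns mul1r ger0_norm//; have := jx0 j; lra.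
have nu1 j : (j <= J + m)%N -> 1 <= `|((idx j)%:R - x ^+ 2) / x|.
  by move=> /nuE ->; have := jx0 j; lra.
have nuL j : (j <= J + m)%N -> `|((idx j)%:R - x ^+ 2) / x| <= L.
  move=> hj; rewrite nuE// -(ler_pM2r x0) mulrDl divfK ?gt_eqF//.
  by have := jx j hj; lra.
have su j : (j <= J + m)%N -> 0 <= a * (b * (((idx j)%:R - x ^+ 2) / x)).
  move=> /uE ->; have -> : a * (b * (s * (th + j%:R / x))) = s * (a * b) * (th + j%:R / x) by ring.
  by rewrite mulr_ge0//; have := jx0 j; clear -th1; lra.
have jp (j : nat) : 0 <= x * th + j%:R.
  by rewrite addr_ge0// mulr_ge0// ?(ltW x0)//; clear -th1; lra.
have xL : x * (10 * L) <= x ^+ 2 by rewrite expr2 ler_wpM2l// ltW.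
have x2 : 0 < x ^+ 2 by rewrite exprn_gt0.
have idx_gt0 j : (j <= J + m)%N -> (0 < idx j)%N.
  by move=> hj; rewrite -(ltr_nat R) idxE//; have := jx j hj; have := jp j; have [->|->] := s1; clear -xL x2; lra.
have idx_le j : (j <= J + m)%N -> (idx j <= n)%N.
  move=> hj; rewrite -(ler_nat R) idxE//; apply: le_trans xn; rewrite lerD2l.
  by have := jx j hj; have := jp j; have [->|->] := s1; clear; lra.
pose dl := 5 * L / x.
have L0 : 0 < L by clear -L8; lra.
have dl0 : 0 <= dl by rewrite divr_ge0 ?mulr_ge0 ?ltW.
have dm : dl * m.+1%:R <= 1 / 2.
  apply: le_trans (ler_wpM2l dl0 m1) _; rewrite /dl le_eqVlt; apply/orP; left.
  by apply/eqP; field; rewrite !gt_eqF.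
pose h j := `|weyl_lin N x a b (idx j)|.
have hr j : (j < J + m)%N -> h j.+1 <= (1 + dl) * h j /\ h j <= (1 + dl) * h j.+1.
  move=> jJ; have jJ' := ltnW jJ.
  have L1 : 1 <= L by clear -L8; lra.
  have L2 : 2 * L <= x by clear -L8 Lx; lra.
  have := idxE _ jJ; have := idxE _ jJ'; rewrite -[j.+1%:R]natr1.
  have [sE|sE] := s1; rewrite sE => e1 e2.
  - have e : idx j.+1 = (idx j).+1.
      by apply/eqP; rewrite -(eqr_nat R) -natr1 e1 e2; apply/eqP; ring.
    have := weyl_lin_ratio N0 x1 L1 L2 (su _ jJ').
    rewrite /h e; rewrite -e; apply; [exact: su | exact: nu1 | exact: nu1 | exact: nuL].
  (* On the left the index decreases along the walk, so the two ratio bounds exchange their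
     roles. *)
  - have e : idx j = (idx j.+1).+1.
      by apply/eqP; rewrite -(eqr_nat R) -natr1 e1 e2; apply/eqP; ring.
    have := weyl_lin_ratio N0 x1 L1 L2 (su _ jJ); rewrite -e.
    move=> /(_ (su _ jJ') (nu1 _ jJ) (nu1 _ jJ') (nuL _ jJ')).
    by rewrite /h => -[].
have h0 : T <= h 0%N.
  apply: le_of_sqr; rewrite ?normr_ge0 ?(ltW T0)// /h real_normK ?num_real//.
  apply: le_trans Tab _; apply: weyl_lin_sqr_ge => //.
  - exact: su.
  - by rewrite nuE// mul0r addr0 th1.
  - exact: idx_gt0.
have JJ : (J <= J + m)%N by rewrite leq_addr.
have hJ : h J < T.
  have := hend (idx J); rewrite nuL// andbT nuE// => e.
  have {}e := e _; rewrite ltNge; apply/negP => Th.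
  have : T ^+ 2 <= weyl_lin N x a b (idx J) ^+ 2.
    by rewrite -[leRHS]real_normK ?num_real// ler_sqr ?nnegrE ?(ltW T0).
  rewrite leNgt e//.
  rewrite -(ler_pM2r x0) mulrDl divfK ?gt_eqF//.
  have : 0 <= th * x by rewrite mulr_ge0 ?(ltW x0)//; clear -th1; lra.
  clear -J1; lra.
have [j0 j0J hj] := slow_crossing T0 dl0 dm hr h0 hJ.
have rng j : j \in iota 0 m.+1 -> (j <= m)%N /\ (j0 + j <= J + m)%N.
  by rewrite mem_iota add0n ltnS => /andP[_ jm]; split=> //; exact: leq_add.
exists [seq idx (j0 + j)%N | j <- iota 0 m.+1]; split.
- rewrite map_inj_in_uniq ?iota_uniq// => i j /rng[_ hi] /rng[_ hj'] /(congr1 (fun k : nat => k%:R : R)).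
  rewrite !idxE// !natrD => e; apply/eqP; rewrite -(eqr_nat R); apply/eqP.
  by have [E|E] := s1; rewrite E in e; clear -e; lra.
- move=> _ /mapP[j /rng[_ jJ] ->]; rewrite mem_iota idx_gt0//=.
  by rewrite add1n ltnS idx_le.
- by rewrite size_map size_iota.
move=> _ /mapP[j /rng[jm jJ] ->].
have /andP[k1 k2] := hj j jm.
have e : `|weyl_lin N y c d (idx (j0 + j)%N)| <= T / 4.
  apply: herr; have := nuL _ jJ; rewrite normrM normfV (gtr0_norm x0).
  by rewrite ler_pdivrMr// mulrC.
have := lerB_normD (weyl_lin N x a b (idx (j0 + j)%N)) (weyl_lin N y c d (idx (j0 + j)%N)).
have := ler_normD (weyl_lin N x a b (idx (j0 + j)%N)) (weyl_lin N y c d (idx (j0 + j)%N)).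
rewrite /h in k1 k2; move=> e1 e2; clear -k1 k2 e e1 e2 T0; apply/andP; split; lra.
Qed.

End Window.

(** * Tail bounds and existence of windows for large [M] *)

Section Asymptotics.
Variable R : realType.
Implicit Types M x y a b c d T L E : R.

Lemma expRN_div_le (e p q : R) : 0 < q -> e * q <= p -> expR (- (p / q)) <= expR (- e).
Proof. by move=> q0 h; rewrite ler_expR lerN2 ler_pdivlMr. Qed.

(** Here [2 (x^2 + i) <= 5 x^2] and [u^2 >= L^2 / 4], so the Chernoff exponent is at least
    [L^2 / 20]; the polynomial factor is at most [2 M^2]. *)
Lemma weyl_lin_sqr_le_window M x a b L MA i :
  1 <= M -> 0 < x -> 8 <= L -> 10 * L <= x -> L <= M -> a ^+ 2 + b ^+ 2 <= MA ->
  L / 2 <= `|(i%:R - x ^+ 2) / x| <= L ->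
  weyl_lin M x a b i ^+ 2 <= 2 * (M ^+ 3 * MA * expR (- (L ^+ 2 / 20))).
Proof.
move=> M1 x0 L8 L10 LM ab /andP[u1 u2].
have M0 : 0 <= M by lra.
apply: le_trans (weyl_lin_sqr_le a b i M0 x0) _.
set u := (i%:R - x ^+ 2) / x in u1 u2 *.
have uE : i%:R - x ^+ 2 = u * x by rewrite /u mulfVK ?gt_eqF.
have uu1 : (L / 2) ^+ 2 <= u ^+ 2.
  by rewrite -[leRHS]real_normK ?num_real// ler_sqr ?nnegrE//; lra.
have uu2 : u ^+ 2 <= L ^+ 2.
  by rewrite -[leLHS]real_normK ?num_real// ler_sqr ?nnegrE//; lra.
have ux : u * x <= L * x by rewrite ler_wpM2r ?(ltW x0)// (le_trans (ler_norm u)).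
have xL10 : x * (10 * L) <= x ^+ 2 by rewrite expr2 ler_wpM2l// ltW.
have h1 : expR (- ((i%:R - x ^+ 2) ^+ 2 / (2 * (x ^+ 2 + i%:R)))) <= expR (- (L ^+ 2 / 20)).
  have xx0 : 0 < x ^+ 2 by rewrite exprn_gt0.
  apply: expRN_div_le; first by rewrite mulr_gt0// ltr_wpDr.
  rewrite uE exprMn.
  have : 2 * (x ^+ 2 + i%:R) <= 5 * x ^+ 2 by lra.
  move=> /(ler_wpM2l (divr_ge0 (sqr_ge0 L) (ler0n _ 20))) /le_trans; apply.
  by have := ler_wpM2r (ltW xx0) uu1; rewrite expr_div_n; lra.
set E := expR (- (L ^+ 2 / 20)) in h1 *.
have LM2 : L ^+ 2 <= M ^+ 2 by rewrite ler_sqr ?nnegrE//; lra.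
have MM : 1 <= M ^+ 2 by rewrite exprn_ege1.
have h2 : 1 + u ^+ 2 <= 2 * M ^+ 2 by lra.
have u0 : 0 <= 1 + u ^+ 2 by rewrite addr_ge0 ?sqr_ge0.
have -> : 2 * (M ^+ 3 * MA * E) = M * E * (MA * (2 * M ^+ 2)) by ring.
apply: ler_pM; rewrite ?mulr_ge0 ?expR_ge0 ?addr_ge0 ?sqr_ge0//.
  by rewrite ler_wpM2l.
by apply: ler_pM; rewrite ?addr_ge0 ?sqr_ge0.
Qed.

(* The windows of [x] and [y] have width of order [M], while [x^2] and [y^2] are at
   distance of order [M D]. *)
Lemma weyl_lin_sqr_le_far c1 c2 M x y c d D MA i :
  let kap := c1 / (4 * c2) in let L := kap * D in
  0 < c1 -> c1 < c2 -> 1 <= M -> 0 < D -> 10 * L <= x ->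
  c1 * M <= x <= c2 * M -> c1 * M <= y <= c2 * M -> D <= `|x - y| ->
  c ^+ 2 + d ^+ 2 <= MA -> `|i%:R - x ^+ 2| <= x * L ->
  weyl_lin M y c d i ^+ 2 <=
    (2 + 4 * c2 ^+ 4 / c1 ^+ 2) * (M ^+ 3 * MA * expR (- (L ^+ 2 / 20))).
Proof.
move=> kap L c10 c12 M1 D0 L10 /andP[x1 x2] /andP[y1 y2] xy cd.
rewrite ler_norml => /andP[i1 i2].
have c20 : 0 < c2 by lra.
have kapE : kap * c2 = c1 / 4 by rewrite /kap; field; lra.
have kap0 : 0 < kap by rewrite divr_gt0//; lra.
have L0 : 0 < L by rewrite mulr_gt0.
have M0 : 0 < M by lra.
have M00 := ltW M0.
have x0 : 0 < x by apply: lt_le_trans x1; rewrite mulr_gt0.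
have y0 : 0 < y by apply: lt_le_trans y1; rewrite mulr_gt0.
have xL10 : x * (10 * L) <= x ^+ 2 by rewrite expr2 ler_wpM2l// ltW.
have c2M : 0 <= c2 * M by rewrite mulr_ge0 ?ltW.
have x22 : x ^+ 2 <= c2 ^+ 2 * M ^+ 2 by rewrite -exprMn ler_sqr ?nnegrE ?(ltW x0).
have y22 : y ^+ 2 <= c2 ^+ 2 * M ^+ 2 by rewrite -exprMn ler_sqr ?nnegrE ?(ltW y0).
have y11 : c1 ^+ 2 * M ^+ 2 <= y ^+ 2.
  by rewrite -exprMn ler_sqr ?nnegrE ?(ltW y0) ?mulr_ge0 ?(ltW c10).
apply: le_trans (weyl_lin_sqr_le c d i M00 y0) _.
have i0 : (0 : R) <= i%:R by [].
pose w := `|i%:R - y ^+ 2|.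
have w2 : (i%:R - y ^+ 2) ^+ 2 = w ^+ 2 by rewrite /w real_normK ?num_real.
have w0 : 0 <= w by exact: normr_ge0.
set cM := c2 ^+ 2 * M ^+ 2 in x22 y22.
have cM0 : 0 <= cM by rewrite mulr_ge0 ?sqr_ge0.
have xL0 : 0 <= x * L by rewrite mulr_ge0 ?ltW.
have ci : i%:R <= 2 * cM by clear -i2 xL10 x22 xL0; lra.
have wub : w <= 2 * cM.
  have := sqr_ge0 y; rewrite /w ler_norml => y20.
  by clear -ci y22 i0 y20 cM0; apply/andP; split; lra.
(* The distance [|x^2 - y^2| >= 2 c1 M D] exceeds the half-width [x L <= c1 M D / 4] of the window;
   this is why [kap = c1 / (4 c2)]. *)
have wlb : c1 * M * D <= w.
  have s1 : `|x ^+ 2 - y ^+ 2| <= x * L + w.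
    apply: (@le_trans _ _ (`|i%:R - x ^+ 2| + w)).
      rewrite -[X in _ <= X + _]normrN; apply: le_trans (ler_normD _ _).
      by rewrite opprB addrA subrK.
    by rewrite lerD2r ler_norml i1.
  have s2 : D * (2 * (c1 * M)) <= `|x ^+ 2 - y ^+ 2|.
    rewrite subr_sqr normrM; apply: ler_pM => //; first exact: ltW.
      by rewrite !mulr_ge0// ltW.
    by rewrite (ger0_norm (addr_ge0 (ltW x0) (ltW y0))); clear -x1 y1; lra.
  have : x * L <= c2 * M * L by rewrite ler_wpM2r// ltW.
  have -> : c2 * M * L = kap * c2 * M * D by rewrite /L; ring.
  have s3 : 0 <= c1 * M * D by rewrite !mulr_ge0 ?ltW.
  rewrite kapE => s4; clear -s1 s2 s3 s4; lra.
(* As [c2 L = c1 D / 4], the exponent [(c1 M D)^2 / (6 c2^2 M^2)] exceeds [L^2 / 20], the rate of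
   the other tail bound. *)
have h1 : expR (- ((i%:R - y ^+ 2) ^+ 2 / (2 * (y ^+ 2 + i%:R)))) <= expR (- (L ^+ 2 / 20)).
  have yy0 : 0 < y ^+ 2 by rewrite exprn_gt0.
  apply: expRN_div_le; first by rewrite mulr_gt0// ltr_wpDr.
  rewrite w2; apply: (@le_trans _ _ ((c1 * M * D) ^+ 2)); last first.
    by rewrite ler_sqr ?nnegrE// !mulr_ge0 ?ltW.
  have s1 : 2 * (y ^+ 2 + i%:R) <= 6 * cM by clear -ci y22; lra.
  apply: le_trans (ler_wpM2l (divr_ge0 (sqr_ge0 L) (ler0n _ 20)) s1) _.
  have -> : L ^+ 2 / 20 * (6 * cM) = 6 / 20 * (kap * c2) ^+ 2 * (M * D) ^+ 2.
    by rewrite /L /cM; field.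
  rewrite kapE -mulrA -[c1 * M * D]mulrA [leRHS]exprMn expr_div_n.
  have := mulr_ge0 (sqr_ge0 c1) (sqr_ge0 (M * D)) => s2; clear -s2; lra.
have h2 : ((i%:R - y ^+ 2) / y) ^+ 2 <= 4 * c2 ^+ 4 / c1 ^+ 2 * M ^+ 2.
  rewrite expr_div_n w2 ler_pdivrMr ?exprn_gt0//.
  apply: (@le_trans _ _ ((2 * cM) ^+ 2)).
    by rewrite ler_sqr ?nnegrE// mulr_ge0.
  have k0 : 0 <= 4 * c2 ^+ 4 / c1 ^+ 2 * M ^+ 2.
    by rewrite mulr_ge0 ?divr_ge0 ?mulr_ge0 ?exprn_ge0// ltW.
  apply: le_trans (ler_wpM2l k0 y11); rewrite le_eqVlt; apply/orP; left.
  by apply/eqP; rewrite /cM; field; rewrite gt_eqF.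
have MM : 1 <= M ^+ 2 by rewrite exprn_ege1.
set v := (i%:R - y ^+ 2) / y in h2 *.
(* The summand 2 lets the same constant dominate the bound of [weyl_lin_sqr_le_window]. *)
set B := 2 + 4 * c2 ^+ 4 / c1 ^+ 2.
have h3 : 1 + v ^+ 2 <= B * M ^+ 2 by rewrite /B; clear -h2 MM; lra.
set E := expR (- (L ^+ 2 / 20)) in h1 *.
have -> : B * (M ^+ 3 * MA * E) = M * E * (MA * (B * M ^+ 2)) by ring.
apply: ler_pM; rewrite ?mulr_ge0 ?expR_ge0 ?addr_ge0 ?sqr_ge0//.
  by rewrite ler_wpM2l.
by apply: ler_pM; rewrite ?addr_ge0 ?sqr_ge0.
Qed.

(* [H] and [D] stand for [M ^ (1/2)] and [M ^ eps], and [MA] for [M ^ A]. *)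
Lemma window_exists (c1 c2 r T M H D MA : R) (n : nat) x y a b c d :
  let kap := c1 / (4 * c2) in let B := 2 + 4 * c2 ^+ 4 / c1 ^+ 2 in
  0 < c1 -> c1 < c2 -> 0 < r -> 0 < T -> T ^+ 2 <= r * expR (- 5) / (4 * c2) ->
  1 <= M -> 0 <= H -> H * H = M -> H <= M -> D <= H ->
  8 / kap <= D -> 10 * kap / c1 <= H ->
  B * (M ^+ 3 * MA * expR (- ((kap * D) ^+ 2 / 20))) <= T ^+ 2 / 32 ->
  c1 * M <= x <= c2 * M -> c1 * M <= y <= c2 * M -> D <= `|x - y| ->
  c2 * M <= Num.sqrt n%:R - M ->
  r / 2 <= a ^+ 2 + b ^+ 2 -> a ^+ 2 + b ^+ 2 <= MA -> c ^+ 2 + d ^+ 2 <= MA ->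
  exists S : seq nat, [/\ uniq S, {subset S <= iota 1 n},
    4 * c2 / 10 * H - 1 <= (size S)%:R &
    forall i, i \in S -> T / 4 <= `|weyl_lin M x a b i + weyl_lin M y c d i| <= 3 * T].
Proof.
move=> kap B c10 c12 r0 T0 Tr M1 H0 HH HM DH hD hH hE xM yM xy nM ab1 ab2 cd2.
have /andP[x1 x2] := xM.
have c20 : 0 < c2 by exact: lt_trans c12.
have kap0 : 0 < kap by rewrite divr_gt0 ?mulr_gt0.
have kap1 : kap <= 1 by rewrite /kap ler_pdivrMr ?mulr_gt0//; clear -c12 c10; lra.
have M0 : 0 < M by exact: lt_le_trans M1.
have M00 := ltW M0.
have D0 : 0 < D by apply: lt_le_trans hD; rewrite divr_gt0.
pose L := kap * D; rewrite -/L in hE.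
have L8 : 8 <= L by rewrite /L mulrC -ler_pdivrMr.
have L0 : 0 <= L by exact: le_trans L8.
have L10 : 10 * L <= x.
  apply: le_trans x1; rewrite -HH /L.
  move: hH; rewrite ler_pdivrMr// => hH.
  have s1 : kap * D <= kap * H by rewrite ler_pM2l.
  have s2 : 10 * kap * H <= H * c1 * H by rewrite ler_wpM2r.
  clear -s1 s2; lra.
have LM : L <= M by rewrite (le_trans _ HM)// (le_trans _ DH)// ler_piMl// ltW.
have x0 : 0 < x by apply: lt_le_trans L10; rewrite mulr_gt0// (lt_le_trans _ L8).
have MA0 : 0 <= MA by apply: le_trans ab2; rewrite addr_ge0 ?sqr_ge0.
have Q0 : 0 <= M ^+ 3 * MA * expR (- (L ^+ 2 / 20)).
  by rewrite !mulr_ge0 ?exprn_ge0 ?expR_ge0.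
have T2 : 0 < T ^+ 2 by rewrite exprn_gt0.
(* The window stays below [n], as [L <= M] and [(x + M)^2 <= n]. *)
have xMn : x ^+ 2 + x * L <= n%:R.
  have n0 : 0 <= n%:R :> R by [].
  rewrite -(sqr_sqrtr n0); apply: (@le_trans _ _ ((x + M) ^+ 2)).
    have s1 : x * L <= x * M by rewrite ler_wpM2l// ltW.
    have s2 : 0 <= x * M by rewrite mulr_ge0// ltW.
    have s3 := sqr_ge0 M; clear -s1 s2 s3; lra.
  rewrite ler_sqr ?nnegrE ?sqrtr_ge0 ?addr_ge0 ?(ltW x0)//.
  by clear -nM x2; lra.
(* The worst case [a^2 + b^2 = r / 2], [x = c2 M] gives exactly the bound assumed on [T^2]. *)
have Tab : T ^+ 2 <= M * expR (- 5) * (a ^+ 2 + b ^+ 2) / (2 * x).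
  apply: (le_trans Tr); rewrite ler_pdivlMr ?mulr_gt0//.
  have -> : r * expR (- 5) / (4 * c2) * (2 * x) = expR (- 5) * (r / 2) * (x / c2).
    by field; rewrite gt_eqF.
  have -> : M * expR (- 5) * (a ^+ 2 + b ^+ 2) = expR (- 5) * (a ^+ 2 + b ^+ 2) * M by ring.
  apply: ler_pM; rewrite ?mulr_ge0 ?expR_ge0 ?invr_ge0 ?(ltW x0) ?(ltW c20) ?(ltW r0)//.
    by rewrite ler_wpM2l ?expR_ge0.
  by rewrite ler_pdivrMr// mulrC.
have hend i : L / 2 <= `|(i%:R - x ^+ 2) / x| <= L -> weyl_lin M x a b i ^+ 2 < T ^+ 2.
  move=> /(weyl_lin_sqr_le_window M1 x0 L8 L10 LM ab2) h; apply: le_lt_trans h _.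
  apply: (@le_lt_trans _ _ (T ^+ 2 / 32)); last by clear -T2; lra.
  by apply: le_trans hE; rewrite ler_wpM2r// /B lerDl divr_ge0 ?mulr_ge0 ?exprn_ge0 ?ltW.
have herr i : `|i%:R - x ^+ 2| <= x * L -> `|weyl_lin M y c d i| <= T / 4.
  move=> /(weyl_lin_sqr_le_far c10 c12 M1 D0 L10 xM yM xy cd2) h.
  apply: le_of_sqr; [exact: normr_ge0 | by rewrite divr_ge0// ltW |].
  rewrite real_normK ?num_real// expr_div_n.
  by apply: (le_trans h); apply: (le_trans hE); clear -T2; lra.
have [S [uS sS szS fS]] := crossing_window M00 T0 L8 L10 xMn Tab hend herr.
exists S; split => //.
rewrite szS.
have L100 : 0 < 10 * L by rewrite mulr_gt0// (lt_le_trans _ L8).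
have q0 : 0 <= x / (10 * L) by rewrite divr_ge0// ltW.
have /andP[_] := truncn_itv q0; rewrite -[(Num.truncn _).+1%:R]natr1 => s1.
(* Since [L = kap D], the quotient [x / (10 L)] is at least [4 c2 M / (10 D)], and [D <= H] leaves a
   multiple of [H]; the [- 1] is the rounding. *)
suff s2 : 4 * c2 / 10 * H <= x / (10 * L) by clear -s1 s2; lra.
rewrite ler_pdivlMr//.
have -> : 4 * c2 / 10 * H * (10 * L) = c1 * (H * D).
  by rewrite /L /kap; field; rewrite gt_eqF.
by apply: le_trans x1; rewrite ler_pM2l// -HH ler_wpM2l.
Qed.

(** With [D = M^eps] the tail exponent is of order [M^(2 eps)], so its exponential beats
    [M^(3 + A)]. The threshold for [M] is chosen before [n], the points and the coefficients, hence
    uniform in them. *)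
Lemma near_window_exists (c1 c2 r A eps T : R) : 0 < c1 -> c1 < c2 -> 0 < r ->
  0 < eps -> eps < 1 / 2 -> 0 < T -> T ^+ 2 <= r * expR (- 5) / (4 * c2) ->
  \forall M \near +oo, forall (n : nat) x y a b c d,
    c1 * M <= x <= c2 * M -> c1 * M <= y <= c2 * M -> powR M eps <= `|x - y| ->
    c2 * M <= Num.sqrt n%:R - M ->
    r / 2 <= a ^+ 2 + b ^+ 2 -> a ^+ 2 + b ^+ 2 <= powR M A ->
    c ^+ 2 + d ^+ 2 <= powR M A ->
    exists S : seq nat, [/\ uniq S, {subset S <= iota 1 n},
      4 * c2 / 10 * powR M (1 / 2) - 1 <= (size S)%:R &
      forall i, i \in S -> T / 4 <= `|weyl_lin M x a b i + weyl_lin M y c d i| <= 3 * T].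
Proof.
move=> c10 c12 r0 e0 e12 T0 Tr.
have c20 : 0 < c2 by lra.
pose kap := c1 / (4 * c2).
have kap0 : 0 < kap by rewrite divr_gt0//; lra.
pose g := kap ^+ 2 / 20.
have g0 : 0 < g by rewrite divr_gt0// exprn_gt0.
have T2 : 0 < T ^+ 2 by rewrite exprn_gt0.
have half0 : 0 < 1 / 2 :> R by [].
have eps20 : 0 < eps * 2 by rewrite mulr_gt0.
pose B := 2 + 4 * c2 ^+ 4 / c1 ^+ 2.
near=> M.
have M1 : 1 <= M by near: M; exact: nbhs_pinfty_ge.
have hD : 8 / kap <= powR M eps by near: M; exact: near_powR_ge.
have hH : 10 * kap / c1 <= powR M (1 / 2) by near: M; exact: near_powR_ge.
have hE : B * 32 / T ^+ 2 * powR M (3 + A) <= expR (g * powR M (eps * 2)).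
  by near: M; exact: near_powR_le_expR.
move=> n x y a b c d xM yM xy nM ab1 ab2 cd2.
have M0 : 0 < M by exact: lt_le_trans M1.
apply: (@window_exists c1 c2 r T M (powR M (1 / 2)) (powR M eps) (powR M A)) => //.
- exact: powR_ge0.
- by rewrite -powRD ?(gt_eqF M0) ?implybT// -splitr powRr1// ltW.
- by rewrite -[leRHS]powRr1 ?(ltW M0)//; apply: ler_powR => //; rewrite ler_pdivrMr// mul1r ler1n.
- by apply: ler_powR => //; exact: ltW.
rewrite -/kap -/B expRN mulrA -ler_pdivlMr ?invr_gt0 ?expR_gt0// invrK.
have D2 : powR M eps ^+ 2 = powR M (eps * 2) by rewrite -powR_mulrn ?powR_ge0// -powRrM.
rewrite exprMn [X in expR X]mulrAC -/g D2 -ler_pdivrMl; last by rewrite divr_gt0.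
apply: le_trans hE; rewrite le_eqVlt; apply/orP; left; apply/eqP.
rewrite powRD ?(gt_eqF M0) ?implybT// (_ : powR M 3 = M ^+ 3) ?powR_mulrn ?(ltW M0)//.
by field; rewrite gt_eqF.
Unshelve. all: by end_near.
Qed.

End Asymptotics.

(** * Product bound *)

Section ProductBound.
Variable R : realType.

(** Factors outside [S] are at most 1, and deleting [I] costs at most [size I] of the factors
    indexed by [S]. *)
Lemma prod_le_exprn (F : nat -> R) (rho : R) (n : nat) (S I : seq nat) :
  (forall i, 0 <= F i <= 1) -> 0 <= rho <= 1 -> uniq S -> {subset S <= iota 1 n} ->
  (forall i, i \in S -> F i <= rho) ->
  \prod_(1 <= i < n.+1 | i \notin I) F i <= rho ^+ (size S - size I).
Proof.
move=> F01 /andP[rho0 rho1] uS sS FS.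
apply: (@le_trans _ _ (\prod_(1 <= i < n.+1 | i \notin I) (if i \in S then rho else 1))).
  apply: ler_prod => i _; have /andP[-> F1] := F01 i.
  by case: ifP => // /FS.
rewrite -big_mkcondr /= big_const_seq iter_mulr_1 -size_filter.
set Q := (Q in rho ^+ size Q).
have : (size S <= size (I ++ Q))%N.
  apply: uniq_leq_size => // i iS; rewrite mem_cat; case: (boolP (i \in I)) => //= iI.
  by rewrite mem_filter iI iS /= /index_iota subn1 /= sS.
rewrite size_cat -leq_subLR => h.
by apply: ler_wiXn2l.
Qed.

Lemma exprn_1B_le (s : R) (k : nat) (t : R) : 0 <= s <= 1 -> t <= k%:R ->
  (1 - s) ^+ k <= expR (- (s * t)).
Proof.
move=> /andP[s0 s1] tk.
apply: (@le_trans _ _ (expR (- s) ^+ k)).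
  apply: lerXn2r; rewrite ?nnegrE ?expR_ge0 ?subr_ge0//; exact: expR_ge1Dx.
by rewrite -expRM_natr ler_expR mulNr lerN2 ler_wpM2l.
Qed.

End ProductBound.

(** * Products of characteristic functions and the final bound *)

Section CharFnProduct.
Variables (R : realType) (dT : measure_display) (T : measurableType dT).
Variables (P : probability T R) (X : {RV P >-> R}).

Lemma normr_charfn t : `|charfn P X t| = (Num.sqrt (charfn_sqr P X t))%:C%C.
Proof. by rewrite charfnE normc_def. Qed.

Lemma normr_prod_charfn (v : nat -> R) (n : nat) (I : seq nat) (z : R) : 0 <= z ->
  \prod_(1 <= i < n.+1 | i \notin I) charfn_sqr P X (v i) <= z ^+ 2 ->
  `|\prod_(1 <= i < n.+1 | i \notin I) charfn P X (v i)| <= complex.Complex z 0.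
Proof.
move=> z0 hz; rewrite normr_prod.
under eq_bigr do rewrite normr_charfn.
rewrite -rmorph_prod lecR; apply: le_of_sqr => //.
  by apply: prodr_ge0 => i _; exact: sqrtr_ge0.
rewrite -prodrXl; apply: le_trans hz; rewrite le_eqVlt; apply/orP; left; apply/eqP.
by apply: eq_bigr => i _; rewrite sqr_sqrtr ?charfn_sqr_ge0.
Qed.

End CharFnProduct.

(** The common form of the three cases, written for [d = 4]; vanishing coefficients give [d = 1] and
    [d = 2]. A window of order [sqrt M] makes the product at most [exp(- k sqrt M)] up to a
    constant, which is below any power of [M]. *)
Lemma near_charfn_prod_le (R : realType) (dT : measure_display) (T : measurableType dT)
    (P : probability T R) (X : {RV P >-> R}) (c1 c2 A C r eps : R) (K : nat) :
  P.-integrable setT (EFin \o X) -> \int[P]_w X w = 0 ->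
  P.-integrable setT (EFin \o (fun w => X w ^+ 2)) -> \int[P]_w (X w ^+ 2) = 1 ->
  0 < c1 -> c1 < c2 -> 0 < r -> 0 < eps -> eps < 1 / 2 ->
  \forall M \near +oo, forall (n : nat) (x y a b c d : R) (v : nat -> R) (I : seq nat),
    c1 * M <= x <= c2 * M -> c1 * M <= y <= c2 * M -> powR M eps <= `|x - y| ->
    c2 * M <= Num.sqrt n%:R - M ->
    r <= a ^+ 2 + b ^+ 2 + (c ^+ 2 + d ^+ 2) ->
    a ^+ 2 + b ^+ 2 + (c ^+ 2 + d ^+ 2) <= powR M A ->
    (size I <= K)%N ->
    (forall i, v i = weyl_lin M x a b i + weyl_lin M y c d i) ->
    `|\prod_(1 <= i < n.+1 | i \notin I) charfn P X (v i)|
      <= complex.Complex (powR M (- C)) 0.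
Proof.
move=> iX eX iX2 eX2 c10 c12 r0 e0 e12.
have [d0 d00 hd0] := charfn_sqr_small iX eX iX2 eX2.
have c20 : 0 < c2 by exact: lt_trans c12.
pose q := r * expR (- 5) / (4 * c2).
have q0 : 0 < q by rewrite divr_gt0 ?mulr_gt0 ?expR_gt0.
(* [3 t <= d0] puts the window in the range of [charfn_sqr_small]; [t <= 1] and [t <= q] give
   [t^2 <= q], the condition of [near_window_exists]. *)
pose t := Num.min (d0 / 3) (Num.min 1 q).
have t0 : 0 < t by rewrite !lt_min divr_gt0//= ltr01.
have td : t <= d0 / 3 by rewrite /t ge_min lexx.
have t1 : t <= 1 by rewrite /t !ge_min lexx !orbT.
have tq : t <= q by rewrite /t !ge_min lexx !orbT.
have t2 : t ^+ 2 <= q by apply: le_trans tq; rewrite expr2 ler_piMr// ltW.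
(* This is [(t / 4)^2 / 8], the gain at the lower end of the window. *)
pose s := t ^+ 2 / 128.
have t20 : 0 < t ^+ 2 by rewrite exprn_gt0.
have t21 : t ^+ 2 <= 1 by rewrite expr_le1// ltW.
have s0 : 0 < s by rewrite divr_gt0.
have s01 : 0 <= s <= 1 by rewrite (ltW s0) /s; clear -t21; lra.
have small u : t / 4 <= `|u| <= 3 * t -> charfn_sqr P X u <= 1 - s.
  move=> /andP[u1 u2]; apply: (le_trans (hd0 u _)).
    by clear -u2 td; lra.
  have : (t / 4) ^+ 2 <= `|u| ^+ 2 by rewrite ler_sqr ?nnegrE// divr_ge0// ltW.
  rewrite real_normK ?num_real// expr_div_n /s => h; clear -h; lra.
have half0 : 0 < 1 / 2 :> R by [].
have k0 : 0 < s * (4 * c2 / 10) by rewrite mulr_gt0// divr_gt0// mulr_gt0.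
near=> M.
have M1 : 1 <= M by near: M; exact: nbhs_pinfty_ge.
(* [2 C] because squared moduli are estimated; [1 + K] pays for the rounding of the window size and
   for the deleted indices. *)
have hE : expR (s * (1 + K%:R)) * powR M (2 * C) <= expR (s * (4 * c2 / 10) * powR M (1 / 2)).
  by near: M; exact: near_powR_le_expR.
have hW : forall (n : nat) x y a b c d,
    c1 * M <= x <= c2 * M -> c1 * M <= y <= c2 * M -> powR M eps <= `|x - y| ->
    c2 * M <= Num.sqrt n%:R - M ->
    r / 2 <= a ^+ 2 + b ^+ 2 -> a ^+ 2 + b ^+ 2 <= powR M A ->
    c ^+ 2 + d ^+ 2 <= powR M A ->
    exists S : seq nat, [/\ uniq S, {subset S <= iota 1 n},
      4 * c2 / 10 * powR M (1 / 2) - 1 <= (size S)%:R &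
      forall i, i \in S -> t / 4 <= `|weyl_lin M x a b i + weyl_lin M y c d i| <= 3 * t].
  by near: M; exact: near_window_exists.
move=> n x y a b c d v I xM yM xy nM rabcd abcdA sI vE.
have M0 : 0 < M by exact: lt_le_trans M1.
have ab0 : 0 <= a ^+ 2 + b ^+ 2 by rewrite addr_ge0 ?sqr_ge0.
have cd0 : 0 <= c ^+ 2 + d ^+ 2 by rewrite addr_ge0 ?sqr_ge0.
have abA : a ^+ 2 + b ^+ 2 <= powR M A by apply: le_trans abcdA; rewrite lerDl.
have cdA : c ^+ 2 + d ^+ 2 <= powR M A by apply: le_trans abcdA; rewrite lerDr.
have [S [uS sS szS fS]] : exists S : seq nat, [/\ uniq S, {subset S <= iota 1 n},
    4 * c2 / 10 * powR M (1 / 2) - 1 <= (size S)%:R &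
    forall i, i \in S -> t / 4 <= `|v i| <= 3 * t].
  (* One of the two points carries at least [r / 2]; if it is [y], the roles of [x] and [y] are
     exchanged. *)
  have [rab|rab] := leP (r / 2) (a ^+ 2 + b ^+ 2).
    have [S [? ? ? fS]] := hW n x y a b c d xM yM xy nM rab abA cdA.
    by exists S; split => // i; rewrite vE; exact: fS.
  have rcd : r / 2 <= c ^+ 2 + d ^+ 2.
    by move: rabcd rab; clear -c10; set A' := a ^+ 2 + b ^+ 2; set B' := c ^+ 2 + d ^+ 2 => *; lra.
  rewrite distrC in xy.
  have [S [? ? ? fS]] := hW n y x c d a b yM xM xy nM rcd cdA abA.
  by exists S; split => // i; rewrite vE addrC; exact: fS.
apply: normr_prod_charfn; first exact: powR_ge0.
apply: (@le_trans _ _ ((1 - s) ^+ (size S - size I))).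
  apply: prod_le_exprn => //.
  - by move=> i; rewrite charfn_sqr_ge0 charfn_sqr_le1.
  - by case/andP: s01 => ? ?; rewrite subr_ge0 gerBl; apply/andP.
  - by move=> i /fS; exact: small.
have szI : 4 * c2 / 10 * powR M (1 / 2) - (1 + K%:R) <= (size S - size I)%:R.
  have : (size S)%:R <= (size S - size I)%:R + K%:R :> R.
    rewrite -natrD ler_nat addnC (@leq_trans (size I + (size S - size I))) ?leq_add2r//.
    by rewrite -leq_subLR.
  by move=> h; clear -h szS; set p := 4 * c2 / 10 * powR M (1 / 2) in szS *; lra.
apply: le_trans (exprn_1B_le s01 szI) _.
rewrite -powR_mulrn ?powR_ge0// -powRrM mulNr powRN [C * 2]mulrC.
rewrite mulrBr -opprB opprK expRD expRN mulrA.
rewrite -ler_pdivlMr ?invr_gt0 ?expR_gt0// invrK.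
by rewrite ler_pdivlMl ?powR_gt0// [leLHS]mulrC.
Unshelve. all: by end_near.
Qed.

(** Supplies a second point when [d] is 1 or 2. The farther endpoint of the interval is at distance
    at least [(c2 - c1) M / 2], which is at least [M^eps] for large [M]. *)
Lemma near_far_point (R : realType) (c1 c2 eps : R) : c1 < c2 -> eps < 1 / 2 ->
  \forall M \near +oo, forall x, c1 * M <= x <= c2 * M ->
    exists2 y, c1 * M <= y <= c2 * M & powR M eps <= `|x - y|.
Proof.
move=> c12 e12; have e1 : 0 < 1 - eps by lra.
have cc : 0 < c2 - c1 by lra.
near=> M.
have M1 : 1 <= M by near: M; exact: nbhs_pinfty_ge.
have hM : 2 / (c2 - c1) <= powR M (1 - eps) by near: M; exact: near_powR_ge.
have M0 : 0 < M by exact: lt_le_trans M1.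
have h : 2 * powR M eps <= (c2 - c1) * M.
  rewrite -ler_pdivrMl// mulrA [_^-1 * 2]mulrC.
  apply: le_trans (ler_wpM2r (powR_ge0 _ _) hM) _.
  by rewrite -powRD ?(gt_eqF M0) ?implybT// subrK powRr1// ltW.
move=> x /andP[x1 x2].
have c12M : c1 * M <= c2 * M by rewrite ler_pM2r// ltW.
set p := powR M eps in h *; set u := c1 * M in x1 c12M *; set v := c2 * M in x2 c12M *.
have {}h : 2 * p <= v - u by rewrite -mulrBl.
have [le|lt] := leP (x - u) (v - x).
  by exists v; rewrite ?lexx ?c12M// distrC (le_trans _ (ler_norm _))//; lra.
by exists u; rewrite ?lexx ?c12M// (le_trans _ (ler_norm _))//; lra.
Unshelve. all: by end_near.
Qed.

Theorem theorem3p18 (R : realType) (c1 c2 : R) (dT : measure_display)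
  (T : measurableType dT) (P : probability T R) (xi : {RV P >-> R})
  (A C : R) (K : nat) (r eps_g : R) :
  0 < c1 -> c1 < c2 ->
  (xi : T -> R) \in Lfun P 2%:E -> ('E_P[xi] = 0)%E -> ('V_P[xi] = 1)%E ->
  0 < A -> 0 < C -> (0 < K)%N -> 0 < r -> 0 < eps_g -> eps_g < 1 / 2 ->
  exists N0 : R, forall (n : nat) (M : R), N0 <= M ->
    (* I_W = [c1 M, c2 M] is contained in [0, sqrt n - M]; N := M *)
    c2 * M <= Num.sqrt n%:R - M ->
    [/\ (* d = 1 *)
        forall x, c1 * M <= x <= c2 * M ->
          cf_product_bound P xi A C K r n M (w1 M x),
        (* d = 2 *)
        forall x, c1 * M <= x <= c2 * M ->
          cf_product_bound P xi A C K r n M (w2 M x)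
      & (* d = 4 *)
        forall x y, c1 * M <= x <= c2 * M -> c1 * M <= y <= c2 * M ->
          powR M eps_g <= `|x - y| ->
          cf_product_bound P xi A C K r n M (w4 M x y)].
Proof.
move=> c10 c12 xi2 E0 V1 _ _ _ r0 e0 e12.
have iX : P.-integrable setT (EFin \o xi) 
  by apply/Lfun1_integrable; apply: Lfun_subset12 => //; exact: fin_num_measure.
have iX2 : P.-integrable setT (EFin \o (fun w => xi w ^+ 2)) by exact: Lfun2_integrable_sqr.
have eX : \int[P]_w xi w = 0 by move: E0; rewrite unlock /Rintegral => ->.
have eX2 : \int[P]_w (xi w ^+ 2) = 1.
  by move: V1; rewrite varianceE// E0 expe2 mule0 sube0 unlock /Rintegral => ->.
have [N [_ hN]] := filterI
  (near_charfn_prod_le A C K iX eX iX2 eX2 c10 c12 r0 e0 e12)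
  (near_far_point c12 e12).
(* Neighbourhoods of [+oo] are given by strict inequalities, hence the [+ 1]. *)
exists (N + 1) => n M NM nM.
have NM1 : N < M by apply: lt_le_trans NM; rewrite ltrDl.
have {hN}[hprod hfar] := hN M NM1.
split.
(* The auxiliary [y] enters with coefficients 0, and [b = 0] removes the term in [c_i(x)]. *)
- move=> x xM I uI sI szI eta r1 r2.
  have [y yM xy] := hfar x xM.
  rewrite /sqnorm big_ord1 in r1 r2.
  apply: (hprod n x y (eta ord0 ord0) 0 0 0) => //.
  + by rewrite expr0n /= !addr0.
  + by rewrite expr0n /= !addr0.
  + by move=> i; rewrite /dotv big_ord1 !weyl_linE mxE; ring.
- move=> x xM I uI sI szI eta r1 r2.
  have [y yM xy] := hfar x xM.
  rewrite /sqnorm !big_ord_recl big_ord0 addr0 in r1 r2.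
  apply: (hprod n x y (eta ord0 ord0) (eta ord0 (lift ord0 ord0)) 0 0) => //.
  + by rewrite expr0n /= !addr0.
  + by rewrite expr0n /= !addr0.
  + by move=> i; rewrite /dotv !big_ord_recl big_ord0 !weyl_linE !mxE /=; ring.
- move=> x y xM yM xy I uI sI szI eta r1 r2.
  rewrite /sqnorm !big_ord_recl big_ord0 addr0 addrA in r1 r2.
  apply: (hprod n x y (eta ord0 ord0) (eta ord0 (lift ord0 ord0))
    (eta ord0 (lift ord0 (lift ord0 ord0)))
    (eta ord0 (lift ord0 (lift ord0 (lift ord0 ord0))))) => //.
  by move=> i; rewrite /dotv !big_ord_recl big_ord0 !weyl_linE !mxE /=; ring.
Qed.
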